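(* Consider the distributed weighted sampling algorithm described in the context, run with parameters $k\ge 1$ (number of sites) and $s\ge 1$ (sample size) on an arbitrary stream $(e_1,w_1),\dots,(e_n,w_n)$ with all $w_i\ge 1$. The assignment of items to sites and the arrival order are arbitrary but fixed in advance, independent of the algorithm's randomness. Let $W=\sum_{i=1}^n w_i$. Then: (i) For every time $t\in[n]$, the set of identifiers returned by the coordinator's query procedure after the $t$-th item has been processed is a weighted random sample without replacement of size $\min\{t,s\}$ from $\{(e_1,w_1),\dots,(e_t,w_t)\}$. (ii) There is an absolute constant $C>0$ such that the expected total number of messages sent, counting both directions, satisfies $$\mathbb{E}[\#\text{messages}]\le C\cdot k\cdot\frac{1+\log(1+W/s)}{\log(1+k/s)}.$$ The paper states this bound as $O\!\left(k\frac{\log(W/s)}{\log(1+k/s)}\right)$.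
   Context: **Weighted sampling without replacement.** A single weighted random sample from a finite collection of items $(e,w)$ with positive weights is one item, where item $(e,w)$ is chosen with probability $w/\sum_{(e',w')}w'$. Occurrences of the same identifier are treated as distinct items. A weighted random sample without replacement (weighted SWOR) of size $m$ from a collection $\mathcal S$ is produced as follows: start with $S=\emptyset$; for $i=1,\dots,m$, draw a single weighted random sample from $\mathcal S\setminus S$ and add it to $S$. **Model.** There are $k$ sites and one coordinator. Stream items $(e_i,w_i)$ arrive one at a time in the global order $i=1,\dots,n$. Each item arrives at one site. Sites and the coordinator exchange messages, each consisting of $O(1)$ words. Every item is fully processed, including all messages it triggers, before the next item arrives. **Algorithm.** Let $r=\max\{2,k/s\}$. The level of a weight $w\ge 1$ is the unique integer $j\ge 0$ with $w\in[r^j,r^{j+1})$. All exponential random variables are rate $1$ and independent of everything else. Every site keeps a flag $\mathrm{sat}_j$ for each level $j$, initially false, and a threshold $\tau$, initially $0$. The coordinator keeps, for each level $j$, a set $D_j$ (initially empty) and a flag $\mathrm{sat}_j$ (initially false). It also keeps a set $S$ of at most $s$ triples $(e,w,v)$, initially empty. Let $u$ denote the smallest key in $S$ if $|S|=s$, and $u=0$ otherwise. *Inserting* $(e,w,v)$ into $S$ means: add it to $S$; if now $|S|>s$, remove the triple with the smallest key. After any change to $S$, if $u\ge 1$ and the integer $j=\lfloor\log_r u\rfloor$ differs from its value after the previous change (or $u$ was previously $<1$), the coordinator sends $r^j$ to all $k$ sites, and each site sets $\tau\leftarrow r^j$. *Site behaviour.* When a site receives $(e,w)$ of level $j$: - If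 $\mathrm{sat}_j$ is false, it sends $(e,w)$ to the coordinator (an early message). - Otherwise it draws an exponential $t$, sets $v=w/t$, and sends $(e,w,v)$ to the coordinator if and only if $v>\tau$ (a regular message). *Coordinator behaviour.* - On an early message $(e,w)$ of level $j$: it draws an exponential $t$ and adds $(e,w,w/t)$ to $D_j$. If then $|D_j|\ge 4rs$, it inserts every triple of $D_j$ into $S$, sets $D_j=\emptyset$ and $\mathrm{sat}_j=$ true, and sends a message to all $k$ sites, which set their $\mathrm{sat}_j$ to true. - On a regular message $(e,w,v)$: if $v>u$, it inserts $(e,w,v)$ into $S$. *Query.* The coordinator returns the identifiers of the $\min\{t,s\}$ triples with the largest keys in $S\cup\bigcup_j D_j$. *)

(* Defs.v *)
From HB Require Import structures.
From mathcomp Require Import all_boot all_order all_algebra.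
From mathcomp Require Import all_classical all_reals all_analysis.
From mathcomp Require Import exponential_distribution.
Set Implicit Arguments.
Unset Strict Implicit.
Unset Printing Implicit Defensive.
Import Order.TTheory GRing.Theory Num.Theory.
Local Open Scope classical_set_scope.
Local Open Scope ring_scope.

(* Stream items are indexed by 0,1,...,n-1 (item i is the (i+1)-th item).   *)
(* Every item i triggers exactly one exponential draw t_i (at the site for  *)
(* a saturated level, at the coordinator for an early message), and its key *)
(* is v_i = w_i / t_i; hence the whole run is a deterministic function of   *)
(* the keys [key : nat -> R].  Triples (e_i,w_i,v_i) are represented by the *)
(* item index i.                                                            *)
Section Algorithm.
Variables (R : realType) (k s : nat).
Variables (w : nat -> R) (site : nat -> 'I_k) (key : nat -> R).

Definition rpar : R := Num.max 2 (k%:R / s%:R).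

(* level of x >= 1: the unique j >= 0 with r^j <= x < r^(j+1) *)
Definition level (x : R) : nat := `| Num.floor (ln x / ln rpar) |%N.

Record state := State {
  ssat  : 'I_k -> nat -> bool;
  stau  : 'I_k -> R;
  pend  : seq nat;              (* union of the sets D_j (D_j = items of level j) *)
  csat  : nat -> bool;
  cS    : seq nat;
  clast : option nat;           (* value of floor(log_r u) after the previous change
                                   of S, or None if u < 1 then *)
  msgs  : nat
}.

Definition minitem (S : seq nat) : nat :=
  foldr (fun x m => if key x < key m then x else m) (head 0%N S) S.

Definition uval (S : seq nat) : R :=
  if size S == s then key (minitem S) else 0.

Definition insertS (S : seq nat) (x : nat) : seq nat :=
  let S' := x :: S in if (s < size S')%N then rem (minitem S') S' else S'.

Definition jof (S : seq nat) : option nat :=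
  if 1 <= uval S then Some (level (uval S)) else None.

(* insert item x into S, then possibly broadcast r^j to all k sites *)
Definition insert_step (st : state) (x : nat) : state :=
  let S' := insertS (cS st) x in
  let c := jof S' in
  match c with
  | Some j =>
      if c != clast st then
        State (ssat st) (fun _ => rpar ^+ j) (pend st) (csat st) S' c (msgs st + k)
      else State (ssat st) (stau st) (pend st) (csat st) S' c (msgs st)
  | None => State (ssat st) (stau st) (pend st) (csat st) S' c (msgs st)
  end.

Definition step (st : state) (i : nat) : state :=
  let j := level (w i) in
  let z := site i in
  if ~~ ssat st z j then
    let st1 := State (ssat st) (stau st) (rcons (pend st) i) (csat st)
                     (cS st) (clast st) (msgs st).+1 in
    let Dj := [seq x <- pend st1 | level (w x) == j] in
    if 4%:R * rpar * s%:R <= (size Dj)%:R then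
      let st2 := foldl insert_step st1 Dj in
      State (fun z' j' => (j' == j) || ssat st2 z' j') (stau st2)
            [seq x <- pend st2 | level (w x) != j]
            (fun j' => (j' == j) || csat st2 j')
            (cS st2) (clast st2) (msgs st2 + k)
    else st1
  else if stau st z < key i then
    let st1 := State (ssat st) (stau st) (pend st) (csat st)
                     (cS st) (clast st) (msgs st).+1 in
    if uval (cS st1) < key i then insert_step st1 i else st1
  else st.

Definition init_state : state :=
  State (fun _ _ => false) (fun _ => 0) [::] (fun _ => false) [::] None 0%N.

Definition run (t : nat) : state := foldl step init_state (iota 0 t).

Definition query (t : nat) : seq nat :=
  let st := run t in
  take (minn t s) (sort (fun a b => key b <= key a) (cS st ++ pend st)).

End Algorithm.

(* Probability that the sequential procedure (draw one weighted sample from *)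
(* the remaining items, add it, repeat) picks the items in the order [l],   *)
(* when the remaining total weight is [tot].                                 *)
Fixpoint seq_prob (R : realType) (w : nat -> R) (tot : R) (l : seq nat) : R :=
  match l with
  | [::] => 1
  | x :: l' => w x / tot * seq_prob w (tot - w x) l'
  end.

(* probability that a weighted SWOR of size |A| from items 0..t-1 is the set
   A (given as a duplicate-free list): sum over all orders of A *)
Definition swor_prob (R : realType) (w : nat -> R) (t : nat) (A : seq nat) : R :=
  \sum_(l <- permutations A) seq_prob w (\sum_(i < t) w i) l.

Definition mutually_independent d (Omega : measurableType d) (R : realType)
    (P : probability Omega R) (n : nat) (T : nat -> {RV P >-> R}) : Prop :=
  forall B : 'I_n -> set R, (forall i, measurable (B i)) ->
    P [set om | forall i : 'I_n, B i (T i om)] =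
    (\prod_(i < n) P (T i @^-1` B i))%E.

Definition exp1_distributed d (Omega : measurableType d) (R : realType)
    (P : probability Omega R) (X : {RV P >-> R}) : Prop :=
  forall B : set R, measurable B ->
    P (X @^-1` B) = exponential_prob (1 : R) B.

Definition keyof d (Omega : measurableType d) (R : realType)
    (P : probability Omega R) (w : nat -> R) (T : nat -> {RV P >-> R})
    (om : Omega) : nat -> R :=
  fun i => w i / T i om.

Arguments rpar {R} k s.
Arguments level {R} k s x.
Arguments run {R} k s w site key t.
Arguments query {R} k s w site key t.
Arguments msgs {R k} _.

(* Main.v *)
(* Correctness: the coordinator always holds the s largest keys, so the query
   returns the items with the smallest arrival times T_i / w_i, independent
   exponentials of rate w_i.  The probability that l_1, ..., l_m arrive first, in
   this order and after time x, is exp(- W x) times the sequential sampling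
   probability; it is found by induction on m from its increments in x.

   Messages: which items are early is deterministic, and at most 4 r s + 1 of them
   share a level.  While r^j <= u < r^(j+1), fewer than s regular items have a key
   above r^(j+1); the number of regular items seen up to that point whose key
   exceeds r^(j+1) is at most s, and a key exceeds r^j at most 2 r times as often,
   so epoch j costs at most 2 r s regular messages and one broadcast.  By Markov's
   inequality u >= r^j has probability at most W / (s r^j), so beyond
   log_r (W / s) the costs of the epochs decay geometrically.  When n < k no level
   ever saturates and only early messages are sent. *)
Require Import Defs.
From HB Require Import structures.
From mathcomp Require Import all_boot all_order all_algebra.
From mathcomp Require Import all_classical all_reals all_analysis.
From mathcomp Require Import exponential_distribution measurable_realfun.
From mathcomp Require Import zify ring lra.
Set Implicit Arguments.
Unset Strict Implicit.
Unset Printing Implicit Defensive.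
Import Order.TTheory GRing.Theory Num.Theory.
Local Open Scope classical_set_scope.
Local Open Scope ring_scope.

(** * Levels and insertion *)

Section Levels.
Variables (R : realType) (k s : nat).
Local Notation r := (@rpar R k s).

(** The law of the arrival order is obtained without joint densities or iterated integrals:
    independence enters only through product formulas for boxes, and two decaying functions whose
    increments over length [h] differ by at most [K * h ^+ 2] must coincide. For the message bound,
    the epoch condition on [u] speaks about the full state of a run. It is weakened to [hits < s],
    where [hits] is an explicit sum of indicators of earlier variables; its independence of the
    current key then follows by recursion, and the counter closes after [s] hits, a Wald-type
    stopping argument. The number of epochs depends on the outcome and has no fixed bound, so
    expectations are bounded by a series. The case [n < k] needs its own argument because the
    general bound contains a term of order [r * s], which equals [k] once [k / s >= 2], while the
    target is of order [k / ln (1 + k / s)] when [W / s] is bounded. *)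

Lemma rpar_ge2 : 2 <= r.
Proof. by rewrite /rpar le_max lexx. Qed.

Lemma rpar_gt0 : 0 < r.
Proof. by apply: lt_le_trans rpar_ge2. Qed.

Lemma rpar_gt1 : 1 < r.
Proof. by apply: lt_le_trans rpar_ge2; rewrite ltr1n. Qed.

Lemma rparX_gt0 j : 0 < r ^+ j.
Proof. by rewrite exprn_gt0// rpar_gt0. Qed.

Lemma rparX_ge1 j : 1 <= r ^+ j.
Proof. by rewrite exprn_ege1// ltW// rpar_gt1. Qed.

Lemma ln_rpar_gt0 : 0 < ln r.
Proof. by rewrite ln_gt0// rpar_gt1. Qed.

Lemma leq_rparM : (0 < s)%N -> k%:R <= r * s%:R.
Proof.
move=> s0; rewrite -ler_pdivrMr ?ltr0n//.
by rewrite /rpar le_max lexx orbT.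
Qed.

Lemma level_bounds (x : R) : 1 <= x ->
  r ^+ level k s x <= x < r ^+ (level k s x).+1.
Proof.
move=> x1; have x0 : 0 < x by apply: lt_le_trans x1.
have q0 : 0 <= ln x / ln r by apply: divr_ge0; [exact: ln_ge0|exact/ltW/ln_rpar_gt0].
have f0 : 0 <= Num.floor (ln x / ln r) by rewrite floor_ge0.
have E : (level k s x)%:R = (Num.floor (ln x / ln r))%:~R :> R.
  by rewrite /level -[in RHS](gez0_abs f0).
have /andP[h1 h2] := floor_itv (ln x / ln r).
rewrite intrD -E in h2; rewrite -E in h1.
rewrite -ler_ln ?posrE ?rparX_gt0// -ltr_ln ?posrE ?rparX_gt0//.
have lnX m : ln (r ^+ m) = m%:R * ln r by rewrite lnXn ?rpar_gt0// mulr_natl.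
rewrite !lnX; move: (level _ _ _) E h1 h2 => j E h1 h2.
by rewrite -ler_pdivlMr ?ln_rpar_gt0// h1/= -ltr_pdivrMr ?ln_rpar_gt0// -natr1.
Qed.

Lemma leq_level (x y : R) : 1 <= x -> x <= y -> (level k s x <= level k s y)%N.
Proof.
move=> x1 xy; have y1 := le_trans x1 xy.
have /andP[a _] := level_bounds x1; have /andP[_ b] := level_bounds y1.
have := le_lt_trans (le_trans a xy) b.
by rewrite ltr_eXn2l ?rpar_gt1// ltnS.
Qed.

End Levels.

Section Insertion.
Variables (R : realType) (s : nat) (key : nat -> R).

(** The start value is arbitrary because the start [head 0 S] used by [minitem] changes with the
    list and would block the induction. *)
Lemma minitem_foldr m0 S :
  let m := foldr (fun x m => if key x < key m then x else m) m0 S in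
  [/\ m \in m0 :: S, key m <= key m0 & forall x, x \in S -> key m <= key x].
Proof.
elim: S => [|a S [IH1 IH2 IH3]] /=; first by rewrite mem_head lexx.
set m := foldr _ _ _ in IH1 IH2 IH3 *.
case: ltP => am; split.
- by rewrite !inE eqxx orbT.
- exact: le_trans (ltW am) IH2.
- move=> x; rewrite inE => /predU1P[->//|/IH3]; exact: le_trans (ltW am).
- by move: IH1; rewrite !inE => /orP[->//|->]; rewrite !orbT.
- by [].
- by move=> x; rewrite inE => /predU1P[->//|/IH3].
Qed.

Lemma minitem_in x S : minitem key (x :: S) \in x :: S.
Proof.
have [+ _ _] := minitem_foldr x (x :: S).
by rewrite inE => /predU1P[|//]; rewrite -/(minitem key (x :: S)) => ->; rewrite mem_head.
Qed.

Lemma minitem_le S x : x \in S -> key (minitem key S) <= key x.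
Proof. by have [_ _] := minitem_foldr (head 0%N S) S; exact. Qed.

(** Translates statements about [u] into statements about the list. Positivity of [y] rules out the
    value 0 of a sample that is not full, and [s0] rules out the default of [head]. *)
Lemma uval_geP (s0 : (0 < s)%N) (y : R) S : 0 < y ->
  y <= uval s key S <-> size S = s /\ forall x, x \in S -> y <= key x.
Proof.
move=> y0; rewrite /uval; case: eqP => Ss; last by rewrite leNgt y0; split => // -[].
case: S Ss => [|a S] Ss; first by rewrite -Ss in s0.
split=> [yu|[_ h]]; last exact/h/minitem_in.
by split=> // x xS; apply: le_trans yu (minitem_le xS).
Qed.

Lemma size_insertS S x : (size S <= s)%N ->
  size (insertS s key S x) = minn s (size S).+1.
Proof.
move=> Ss; rewrite /insertS; case: ltnP => h; last by move: h => /=; lia.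
by rewrite size_rem ?minitem_in//; move: h => /=; lia.
Qed.

Lemma insertS_sub S x : {subset insertS s key S x <= x :: S}.
Proof. by move=> z; rewrite /insertS; case: ifP => // _ /mem_rem. Qed.

Lemma insertS_uniq S x : uniq (x :: S) -> uniq (insertS s key S x).
Proof. by rewrite /insertS; case: ifP => // _; apply: rem_uniq. Qed.

(** Only the minimum is evicted. If it is itself counted, all [s + 1] keys were counted, so [s] of
    them remain; otherwise the count is unchanged. *)
Lemma count_insertS (y : R) S x : (size S <= s)%N ->
  (minn s (count (fun z => (y <= key z)%R) (x :: S)) <=
   count (fun z => (y <= key z)%R) (insertS s key S x))%N.
Proof.
move=> Ss; rewrite /insertS; case: ltnP => h; last exact: geq_minr.
set m := minitem _ _; rewrite count_rem minitem_in.
case: (boolP (y <= key m)) => ym; last by rewrite subn0 geq_minr.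
suff -> : count (fun z => y <= key z) (x :: S) = (size (x :: S)) by move: h => /=; lia.
apply/eqP; rewrite -all_count; apply/allP => z zS.
exact: le_trans ym (minitem_le zS).
Qed.

(** Either the newcomer is evicted at once, or the evicted minimum was an old item with key at least
    [v] and every survivor lies above it. *)
Lemma insertS_keep S x (v : R) : size S = s -> (forall z, z \in S -> v <= key z) ->
  forall z, z \in insertS s key S x -> v <= key z.
Proof.
move=> Ss hS z; rewrite /insertS [size _]/= Ss ltnSn.
set m := minitem _ _ => zm.
have := minitem_in x S; rewrite inE -/m => /predU1P[mx|mS].
  by apply: hS; move: zm; rewrite mx /= eqxx.
by apply: le_trans (hS _ mS) (minitem_le _); exact: mem_rem zm.
Qed.

Lemma insertS_lost S x i : (size S <= s)%N -> uniq (x :: S) -> i \in x :: S ->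
  i \notin insertS s key S x ->
  size S = s /\ forall z, z \in insertS s key S x -> key i <= key z.
Proof.
move=> Ss U iS; rewrite /insertS; case: ltnP => h; last by rewrite iS.
set m := minitem _ _ => im.
have -> : i = m by apply/eqP/negPn/negP => ne; move: im; rewrite mem_rem_uniq// inE ne iS.
split; first by apply/eqP; rewrite eqn_leq Ss -ltnS.
by move=> z zS; apply: minitem_le; exact: mem_rem zS.
Qed.

Definition kept (S : seq nat) (X : nat -> Prop) : Prop :=
  [/\ uniq S, (forall x, x \in S -> X x) & (size S <= s)%N].

(** With [kept], this says that [S] holds the top [s] keys among the items [X] offered so far, with
    ties allowed. The two are separate because along a run [kept] holds for all keys, whereas
    [dominated] is proved for positive ones. *)
Definition dominated (S : seq nat) (X : nat -> Prop) : Prop :=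
  forall i, X i -> i \notin S -> size S = s /\ forall x, x \in S -> key i <= key x.

Lemma kept_insert S (X : nat -> Prop) x : kept S X -> ~ X x ->
  kept (insertS s key S x) (fun i => i = x \/ X i).
Proof.
move=> [U SX Ss] xX; have xS : x \notin S by apply/negP => /SX.
split; first by apply: insertS_uniq; rewrite /= xS.
  by move=> z /insertS_sub; rewrite inE => /predU1P[->|/SX]; [left|right].
by rewrite size_insertS// geq_minl.
Qed.

Lemma dominated_insert S (X : nat -> Prop) x : kept S X -> ~ X x -> dominated S X ->
  dominated (insertS s key S x) (fun i => i = x \/ X i).
Proof.
move=> [U SX Ss] xX D i Xi iS'.
have xS : x \notin S by apply/negP => /SX.
have U' : uniq (x :: S) by rewrite /= xS.
have [iS|iS] := boolP (i \in x :: S).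
  have [E h] := insertS_lost Ss U' iS iS'.
  by split=> //; rewrite size_insertS// E; lia.
have [E h] : size S = s /\ forall z, z \in S -> key i <= key z.
  apply: D; last by move: iS; rewrite inE negb_or => /andP[].
  by case: Xi => // ix; rewrite ix mem_head in iS.
split; first by rewrite size_insertS// E; lia.
exact: insertS_keep.
Qed.

Lemma kept_ext S (X Y : nat -> Prop) : (forall i, X i <-> Y i) -> kept S X -> kept S Y.
Proof. by move=> XY [U SX Ss]; split=> // x /SX/XY. Qed.

Lemma dominated_ext S (X Y : nat -> Prop) : (forall i, X i <-> Y i) ->
  dominated S X -> dominated S Y.
Proof. by move=> XY D i /XY/D. Qed.

Lemma kept_foldl S (X : nat -> Prop) D : kept S X -> uniq D ->
  (forall x, x \in D -> ~ X x) ->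
  kept (foldl (insertS s key) S D) (fun i => i \in D \/ X i) /\
  (dominated S X -> dominated (foldl (insertS s key) S D) (fun i => i \in D \/ X i)).
Proof.
elim: D S X => [|a D IH] S X K /=.
  move=> _ _; have E i : X i <-> (i \in [::] \/ X i) by split; [right|case].
  by split; [exact: kept_ext K|exact: dominated_ext].
move=> /andP[aD U] DX.
have aX : ~ X a by apply: DX; rewrite mem_head.
have K' := kept_insert K aX.
have E i : (i \in D \/ (i = a \/ X i)) <-> (i \in a :: D \/ X i).
  rewrite inE; split=> [[h|[->|h]]|[/predU1P[->|h]|h]].
  - by left; rewrite h orbT.
  - by left; rewrite eqxx.
  - by right.
  - by right; left.
  - by left.
  - by right; right.
have [] := IH _ _ K' U.
  by move=> x xD [xa|]; [rewrite xa (negbTE aD) in xD|apply: DX; rewrite inE xD orbT].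
move=> K2 D2; split; first exact: kept_ext K2.
by move=> Dm; apply: dominated_ext E _; apply: D2; apply: dominated_insert.
Qed.

End Insertion.

(** * Invariants of a run *)

Section Run.
Variables (R : realType) (k s : nat) (w : nat -> R) (site : nat -> 'I_k).
Hypothesis s0 : (0 < s)%N.
Local Notation r := (@rpar R k s).
Local Notation lev i := (level k s (w i)).

Definition tauof (c : option nat) : R := if c is Some j then r ^+ j else 0.
(** A potential for broadcasts: announced indices strictly increase, so reaching index [j] costs at
    most [j.+1] of them. *)
Definition nbcast (c : option nat) : nat := if c is Some j then j.+1 else 0%N.

Section Key.
Variable key : nat -> R.

Lemma jofP S : match jof k s key S with
  | Some j => r ^+ j <= uval s key S < r ^+ j.+1
  | None => uval s key S < 1 end.
Proof. by rewrite /jof; case: leP => // u1; exact: level_bounds. Qed.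

(** The filter at the sites is safe: the threshold is [u] rounded down to a power of [r], so a key
    withheld by a site is beaten by a full sample. *)
Lemma tauof_jof_le (S : seq nat) (v : R) : 0 < v -> v <= tauof (jof k s key S) ->
  size S = s /\ forall x, x \in S -> v <= key x.
Proof.
move=> v0; have := jofP S; case: jof => [j /= /andP[h _] vt|/= _]; last by rewrite leNgt v0.
by apply/uval_geP => //; exact: le_trans h.
Qed.

Lemma uval_insertS S x : 1 <= uval s key S -> uval s key S <= uval s key (insertS s key S x).
Proof.
move=> u1; have u0 : 0 < uval s key S by apply: lt_le_trans u1.
have [Ss h] := (uval_geP key s0 S u0).1 (lexx _).
apply/uval_geP => //; split; last exact: insertS_keep.
by rewrite size_insertS Ss//; lia.
Qed.

Lemma nbcast_insertS S x :
  (nbcast (jof k s key S) <= nbcast (jof k s key (insertS s key S x)))%N.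
Proof.
rewrite {1}/jof; case: ifP => // u1.
have u2 := uval_insertS x u1.
by rewrite /jof (le_trans u1 u2) /= ltnS leq_level.
Qed.

Definition tracked (st : state R k) :=
  [/\ clast st = jof k s key (cS st), forall z, stau st z = tauof (clast st)
    & (size (cS st) <= s)%N].

Lemma insert_step_fields (st : state R k) x :
  [/\ cS (insert_step s key st x) = insertS s key (cS st) x,
      ssat (insert_step s key st x) = ssat st,
      pend (insert_step s key st x) = pend st &
      csat (insert_step s key st x) = csat st].
Proof. by rewrite /insert_step; case: jof => // j; case: ifP. Qed.

(** A broadcast occurs only when the index changes; as the potential never drops, it then rises by
    at least one and pays the [k] messages. Both sides are sums to avoid subtraction in [nat]. *)
Lemma insert_step_tracked (st : state R k) x : tracked st ->
  tracked (insert_step s key st x) /\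
  (msgs (insert_step s key st x) + k * nbcast (clast st) <=
   msgs st + k * nbcast (clast (insert_step s key st x)))%N.
Proof.
move=> [E1 E2 E3].
have Ss : (size (insertS s key (cS st) x) <= s)%N by rewrite size_insertS// geq_minl.
have := nbcast_insertS (cS st) x; rewrite -E1 /tracked /insert_step.
case J: jof => [j|] /= nb.
  case: eqP => /= jc; first by rewrite J -jc; split=> //; split=> // z; rewrite E2 -jc.
  split=> //; rewrite -addnA leq_add2l.
  have : (nbcast (clast st) < j.+1)%N.
    rewrite ltn_neqAle nb andbT; apply/eqP => h; apply: jc.
    by case: (clast st) h => //= j' [->].
  by move=> h; rewrite -mulnS leq_mul2l h orbT.
have c0 : clast st = None by case: (clast st) nb.
by rewrite J c0; split=> //; split=> // z; rewrite E2 c0.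
Qed.

Lemma foldl_insert_fields (st : state R k) D :
  let st2 := foldl (insert_step s key) st D in
  [/\ cS st2 = foldl (insertS s key) (cS st) D,
      ssat st2 = ssat st, pend st2 = pend st & csat st2 = csat st].
Proof.
elim: D st => //= x D IH st; have [A B C E] := IH (insert_step s key st x).
by have [A' B' C' E'] := insert_step_fields st x; rewrite A B C E A' B' C' E'.
Qed.

Lemma foldl_insert_tracked (st : state R k) D : tracked st ->
  let st2 := foldl (insert_step s key) st D in
  tracked st2 /\
  (msgs st2 + k * nbcast (clast st) <= msgs st + k * nbcast (clast st2))%N.
Proof.
elim: D st => //= x D IH st /(insert_step_tracked x)[T1 M1].
have [T2 M2] := IH _ T1; split=> //; lia.
Qed.

Lemma foldl_insert_count (y : R) S D : (size S <= s)%N ->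
  (minn s (count (fun z => (y <= key z)%R) S) <=
   count (fun z => (y <= key z)%R) (foldl (insertS s key) S D))%N.
Proof.
elim: D S => [|x D IH] S Ss /=; first exact: geq_minr.
have := IH (insertS s key S x); rewrite size_insertS// geq_minl => /(_ isT).
have /= := count_insertS key y x Ss; lia.
Qed.

(** The outcomes of a step. In [StepSat] the saturation flags and pending list are written in terms
    of the old state, since insertions touch neither. *)
Variant step_spec (st : state R k) (i : nat) : state R k -> Prop :=
| StepPend of ssat st (site i) (lev i) = false
    & (size [seq x <- rcons (pend st) i | lev x == lev i])%:R < 4%:R * r * s%:R :
    step_spec st i (State (ssat st) (stau st) (rcons (pend st) i) (csat st)
                     (cS st) (clast st) (msgs st).+1)
| StepSat of ssat st (site i) (lev i) = false
    & 4%:R * r * s%:R <= (size [seq x <- rcons (pend st) i | lev x == lev i])%:R :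
    let st2 := foldl (insert_step s key)
      (State (ssat st) (stau st) (rcons (pend st) i) (csat st)
                     (cS st) (clast st) (msgs st).+1)
      [seq x <- rcons (pend st) i | lev x == lev i] in
    step_spec st i (State (fun z' j' => (j' == lev i) || ssat st z' j') (stau st2)
            [seq x <- rcons (pend st) i | lev x != lev i]
            (fun j' => (j' == lev i) || csat st j')
            (cS st2) (clast st2) (msgs st2 + k))
| StepSkip of ssat st (site i) (lev i) & key i <= stau st (site i) : step_spec st i st
| StepDrop of ssat st (site i) (lev i) & stau st (site i) < key i & key i <= uval s key (cS st) :
    step_spec st i (State (ssat st) (stau st) (pend st) (csat st)
                     (cS st) (clast st) (msgs st).+1)
| StepInsert of ssat st (site i) (lev i) & stau st (site i) < key i & uval s key (cS st) < key i :
    step_spec st i (insert_step s key (State (ssat st) (stau st) (pend st) (csat st)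
                     (cS st) (clast st) (msgs st).+1) i).

Lemma stepP st i : step_spec st i (step s w site key st i).
Proof.
rewrite /step /=; case: ifPn => [/negbTE|] sat.
  case: leP => D; last exact: StepPend.
  set st1 := State _ _ (rcons _ _) _ _ _ _; have [_ E1 E2 E3] := foldl_insert_fields st1
     [seq x <- rcons (pend st) i | lev x == lev i].
  by rewrite E1 E2 E3; exact: StepSat.
rewrite negbK in sat; case: ltP => h; last exact: StepSkip.
by case: ltP => h'; [exact: StepInsert|exact: StepDrop].
Qed.

Lemma runS t : run k s w site key t.+1 = step s w site key (run k s w site key t) t.
Proof. by rewrite /run -addn1 iotaD foldl_cat. Qed.

Definition regular i := ssat (run k s w site key i) (site i) (lev i).
Definition sent i := stau (run k s w site key i) (site i) < key i.

(* The factor 2 pays for saturation: the second unit of an early message is kept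
   in [size (pend st)], and a level that saturates releases at least
   [4 r s >= k] pending items at the cost of [k] messages. *)
Lemma run_tracked t : tracked (run k s w site key t) /\
  (msgs (run k s w site key t) + size (pend (run k s w site key t)) <=
   2 * \sum_(0 <= i < t) ~~ regular i + \sum_(0 <= i < t) (regular i && sent i)
   + k * nbcast (clast (run k s w site key t)))%N.
Proof.
elim: t => [|t [T M]].
  rewrite !big_geq//= muln0; split=> //.
  rewrite /run /=; split=> //=; rewrite /jof /uval /=.
  by rewrite eq_sym eqn0Ngt s0 /= ler10.
rewrite !big_nat_recr//= runS /regular /sent.
set st := run k s w site key t in T M *.
set A := (\sum_(_ <= _ < _) _)%N in M *; set B := (\sum_(_ <= _ < _) _)%N in M *.
have [T1 T2 T3] := T.
case: stepP => [sat D|sat D st2|sat h|sat h1 h2|sat h1 h2]; rewrite sat /=.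
- by split=> //; rewrite size_rcons; lia.
- have [T' M'] : tracked st2 /\ _ := foldl_insert_tracked
    [seq x <- rcons (pend st) t | lev x == lev t]
    (st := State (ssat st) (stau st) (rcons (pend st) t) (csat st)
                     (cS st) (clast st) (msgs st).+1) T.
  split; first exact: T'.
  rewrite -/st2 /= in M'.
  have kD : (k <= size [seq x <- rcons (pend st) t | lev x == lev t])%N.
    rewrite -(ler_nat R); apply: le_trans D; apply: le_trans (leq_rparM R k s0) _.
    rewrite -mulrA; have : 0 <= r * s%:R by rewrite mulr_ge0// ltW// rpar_gt0.
    lra.
  have := count_predC (fun x => lev x == lev t) (rcons (pend st) t).
  rewrite -!size_filter size_rcons => E.
  have {}E : (size [seq x <- rcons (pend st) t | lev x == lev t] +
    size [seq x <- rcons (pend st) t | lev x != lev t] = (size (pend st)).+1)%N by [].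
  set a := size _ in kD E *; set b := size _ in E *.
  lia.
- by rewrite ltNge h /=; split=> //; lia.
- by rewrite h1 /=; split=> //; lia.
- have [T' M'] := insert_step_tracked t
    (st := State (ssat st) (stau st) (pend st) (csat st)
                     (cS st) (clast st) (msgs st).+1) T.
  split=> //; rewrite h1; have [_ _ -> _] := insert_step_fields (State (ssat st) (stau st) (pend st) (csat st)
                     (cS st) (clast st) (msgs st).+1) t.
  by move: M' => /=; lia.
Qed.

(** The items offered to [S] are those that arrived and are no longer pending; saturation moves a
    whole level from one class to the other. Positive keys matter because the initial threshold 0
    discards the others while [S] is not full. *)
Lemma run_kept t : let st := run k s w site key t in
  [/\ uniq (pend st), (forall x, x \in pend st -> (x < t)%N),
      kept s (cS st) (fun i => (i < t)%N /\ i \notin pend st) &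
      (forall i, (i < t)%N -> 0 < key i) ->
      dominated s key (cS st) (fun i => (i < t)%N /\ i \notin pend st)].
Proof.
elim: t => [|t]; first by split=> // _ i [].
rewrite runS; set st := run _ _ _ _ _ t => /= -[U Pt K Dm].
have [[T1 T2 T3] _] := run_tracked t; rewrite -/st in T1 T2 T3.
have tP : t \notin pend st by apply/negP => /Pt; rewrite ltnn.
have UP : uniq (rcons (pend st) t) by rewrite rcons_uniq tP.
have Pt' x : x \in rcons (pend st) t -> (x < t.+1)%N.
  by rewrite mem_rcons inE => /predU1P[->//|/Pt/ltnW].
have pos : (forall i, (i < t.+1)%N -> 0 < key i) -> forall i, (i < t)%N -> 0 < key i.
  by move=> h i it; apply: h; exact: ltnW.
have XE i : ((i < t)%N /\ i \notin pend st) <-> ((i < t.+1)%N /\ i \notin rcons (pend st) t).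
  rewrite mem_rcons inE negb_or ltnS [(i <= t)%N]leq_eqVlt; split.
    by move=> [it ->]; rewrite it orbT (ltn_eqF it).
  by move=> [/predU1P[->|->]]; rewrite ?eqxx// => /andP[].
have XE' i : (i = t \/ ((i < t)%N /\ i \notin pend st)) <-> ((i < t.+1)%N /\ i \notin pend st).
  rewrite ltnS [(i <= t)%N]leq_eqVlt; split.
    by move=> [->|[-> ->]]; rewrite ?eqxx ?orbT.
  by move=> [/predU1P[->|->] ->]; [left|right].
have nX : ~ ((t < t)%N /\ t \notin pend st) by rewrite ltnn; case.
have Kt : kept s (cS st) (fun i => (i < t.+1)%N /\ i \notin pend st).
  by case: K => a b c; split=> // x /b h; apply/XE'; right.
(* A discarded item enlarges the offered set while [S] stays the same, so [S] must already be full
   and above it. *)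
have drop : size (cS st) = s /\ (forall x, x \in cS st -> key t <= key x) ->
    (forall i, (i < t.+1)%N -> 0 < key i) ->
    dominated s key (cS st) (fun i => (i < t.+1)%N /\ i \notin pend st).
  by move=> h /pos/Dm D i /XE'[->//|]; exact: D.
have t0 : (forall i, (i < t.+1)%N -> 0 < key i) -> 0 < key t by exact.
case: stepP => [sat D|sat D st2|sat h|sat h1 h2|sat h1 h2] /=.
- split=> //; first exact: kept_ext K.
  by move=> /pos/Dm; exact: dominated_ext.
- have [-> _ _ _] : [/\ cS st2 = _, _, _ & _] := foldl_insert_fields _ _.
  rewrite /=; set Dj := [seq x <- _ | _ == _]; set Pj := [seq x <- _ | _].
  have YE i : (i \in Dj \/ ((i < t)%N /\ i \notin pend st)) <-> ((i < t.+1)%N /\ i \notin Pj).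
    rewrite !mem_filter; split.
      move=> [/andP[-> /Pt' ->//]|/XE[-> /negbTE ->]]; by rewrite andbF.
    move=> [it]; rewrite negb_and negbK.
    have [iP|iP] := boolP (i \in rcons (pend st) t).
      by rewrite orbF => ->; left.
    by move=> _; right; apply/XE.
  have DX x : x \in Dj -> ~ ((x < t)%N /\ x \notin pend st).
    by rewrite mem_filter => /andP[_ xP] /XE[_]; rewrite xP.
  have [K' D'] := kept_foldl key K (filter_uniq _ UP : uniq Dj) DX.
  split; first exact: filter_uniq.
  + by move=> x; rewrite mem_filter => /andP[_ /Pt'].
  + exact: kept_ext YE K'.
  + by move=> /pos/Dm/D'; exact: dominated_ext.
- split=> //; first by move=> x /Pt/ltnW.
  move=> ps; apply: drop => //; apply: tauof_jof_le; first exact: t0.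
  by rewrite -T1 -(T2 (site t)).
- split=> //; first by move=> x /Pt/ltnW.
  by move=> ps; apply: drop => //; apply/uval_geP => //; exact: t0.
- have [-> _ -> _] := insert_step_fields (State (ssat st) (stau st) (pend st) (csat st)
                     (cS st) (clast st) (msgs st).+1) t.
  split=> //=; first by move=> x /Pt/ltnW.
    exact: kept_ext XE' (kept_insert key K nX).
  by move=> /pos/Dm h; apply: dominated_ext XE' _; exact: dominated_insert.
Qed.

Definition regcount (y : R) t := (\sum_(0 <= i < t) (regular i && (y <= key i)%R))%N.

(** Insertions never lower the capped count, and a regular item with key at least [y] is discarded
    only when [S] is already full of such keys. The cap at [s] reflects the size of [S]. *)
Lemma run_count (y : R) t : 1 <= y ->
  (minn s (regcount y t) <= count (fun z => (y <= key z)%R) (cS (run k s w site key t)))%N.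
Proof.
move=> y1; have y0 : 0 < y by apply: lt_le_trans y1.
elim: t => [|t]; first by rewrite /regcount big_geq//= minn0.
have [[T1 T2 T3] _] := run_tracked t.
rewrite /regcount big_nat_recr//= runS /regular; set N := (\sum_(_ <= _ < _) _)%N.
set st := run _ _ _ _ _ t in T1 T2 T3 * => IH.
have full S : (size S = s /\ forall x, x \in S -> y <= key x) ->
    count (fun z => y <= key z) S = s.
  by move=> [<- h]; apply/eqP; rewrite -all_count; apply/allP.
case: stepP => [sat D|sat D st2|sat h|sat h1 h2|sat h1 h2]; rewrite sat /=.
- by rewrite addn0.
- have [-> _ _ _] : [/\ cS st2 = _, _, _ & _] := foldl_insert_fields _ _.
  have /= := foldl_insert_count y [seq x <- rcons (pend st) t | lev x == lev t] T3.
  lia.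
- case: (boolP (y <= key t)) => yt; last by rewrite addn0.
  rewrite full ?geq_minl//; apply: tauof_jof_le => //.
  by rewrite -T1 -(T2 (site t)); exact: le_trans h.
- case: (boolP (y <= key t)) => yt; last by rewrite addn0.
  by rewrite full ?geq_minl//; apply/uval_geP => //; exact: le_trans h2.
- have [-> _ _ _] := insert_step_fields (State (ssat st) (stau st) (pend st) (csat st)
                     (cS st) (clast st) (msgs st).+1) t.
  by have /= := count_insertS key y t T3; lia.
Qed.

Lemma regcount_lt (y : R) t : 1 <= y -> uval s key (cS (run k s w site key t)) < y ->
  (regcount y t < s)%N.
Proof.
move=> y1 uy; rewrite ltnNge; apply/negP => Ns.
have := run_count t y1; rewrite (minn_idPl Ns) => sc.
have [[_ _ T3] _] := run_tracked t.
move: uy; rewrite ltNge => /negP; apply; apply/uval_geP => //; first exact: lt_le_trans y1.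
have := count_size (fun z => y <= key z) (cS (run k s w site key t)) => cs.
have E : size (cS (run k s w site key t)) = s.
  by apply/eqP; rewrite eqn_leq T3 (leq_trans sc cs).
by split=> //; apply/allP; rewrite all_count eqn_leq cs E sc.
Qed.

Lemma count_key_ge (y : R) t : 0 < y -> y <= uval s key (cS (run k s w site key t)) ->
  (s <= \sum_(0 <= i < t) (y <= key i)%R)%N.
Proof.
move=> y0 /uval_geP[]// Ss h; have [_ _ [U X _] _] := run_kept t.
rewrite -Ss.
have : {subset cS (run k s w site key t) <= [seq i <- iota 0 t | y <= key i]}.
  by move=> x xS; rewrite mem_filter mem_iota h//=; have [] := X _ xS.
move=> /(uniq_leq_size U)/leq_trans; apply.
by rewrite size_filter -sum1_count big_mkcond /index_iota subn0.
Qed.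

End Key.
End Run.

(** * Saturation, early messages, and the output of the query *)

Section Saturation.
Variables (R : realType) (k s : nat) (w : nat -> R) (site : nat -> 'I_k).
Hypothesis s0 : (0 < s)%N.
Local Notation r := (@rpar R k s).
Local Notation lev i := (level k s (w i)).
Local Notation run := (run k s w site).

Lemma step_ssat_pend key st i :
  ssat (step s w site key st i) =
    (if ssat st (site i) (lev i) then ssat st
     else if 4%:R * r * s%:R <= (size [seq x <- rcons (pend st) i | lev x == lev i])%:R
     then (fun z' j' => (j' == lev i) || ssat st z' j') else ssat st) /\
  pend (step s w site key st i) =
    (if ssat st (site i) (lev i) then pend st
     else if 4%:R * r * s%:R <= (size [seq x <- rcons (pend st) i | lev x == lev i])%:R
     then [seq x <- rcons (pend st) i | lev x != lev i] else rcons (pend st) i).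
Proof.
case: stepP => [sat D|sat D st2|sat h|sat h1 h2|sat h1 h2]; rewrite sat //.
- by rewrite leNgt D.
- by rewrite D.
- by have [_ -> -> _] := insert_step_fields s key (State (ssat st) (stau st) (pend st) (csat st)
                     (cS st) (clast st) (msgs st).+1) i.
Qed.

(** Flags and pending lists evolve from weights and sites alone. Hence being early or regular is a
    deterministic property of the stream, and [regular] may be evaluated at a dummy key. *)
Lemma run_key_irrelevant key key' t :
  ssat (run key t) = ssat (run key' t) /\ pend (run key t) = pend (run key' t).
Proof.
elim: t => // t [E1 E2]; rewrite !runS.
have [-> ->] := step_ssat_pend key (run key t) t.
by have [-> ->] := step_ssat_pend key' (run key' t) t; rewrite E1 E2.
Qed.

Lemma regular_key_irrelevant key key' i : regular s w site key i = regular s w site key' i.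
Proof. by rewrite /regular; have [-> _] := run_key_irrelevant key key' i. Qed.

(** While a level is unsaturated, all its early items are still pending, so their number is below
    [4 * r * s]. The extra 1 is the item that triggers saturation. *)
Lemma early_per_level key t : let st := run key t in
  (forall z j, ssat st z j = csat st j) /\
  forall j, let e := (\sum_(0 <= i < t) (~~ regular s w site key i && (lev i == j)))%N in
    e%:R <= 4 * r * s%:R + 1 /\
    (~~ csat st j -> e = size [seq x <- pend st | lev x == j] /\ e%:R < 4 * r * s%:R).
Proof.
have rs0 : 0 < 4 * r * s%:R by rewrite !mulr_gt0 ?ltr0n// rpar_gt0.
elim: t => [|t].
  by split=> // j /=; rewrite big_geq//; split=> //; rewrite addr_ge0// ltW.
set st := run key t => /= -[ES H]; rewrite runS -/st.
have H' j : regular s w site key t \/ lev t != j ->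
    (\sum_(0 <= i < t.+1) (~~ regular s w site key i && (lev i == j)) =
     \sum_(0 <= i < t) (~~ regular s w site key i && (lev i == j)))%N.
  rewrite big_nat_recr//=; case: (regular s w site key t) => /=; first by rewrite addn0.
  by case=> // /negbTE ->; rewrite addn0.
have Hreg : regular s w site key t -> forall j, let e := (\sum_(0 <= i < t.+1) (~~ regular s w site key i && (lev i == j)))%N in
    e%:R <= 4 * r * s%:R + 1 /\
    (~~ csat st j -> e = size [seq x <- pend st | lev x == j] /\ e%:R < 4 * r * s%:R).
  by move=> rt j; rewrite H'//; left.
have Hnew : ssat st (site t) (lev t) = false ->
  (\sum_(0 <= i < t.+1) (~~ regular s w site key i && (lev i == lev t)) =
     size [seq x <- rcons (pend st) t | lev x == lev t])%N /\
  (size [seq x <- rcons (pend st) t | lev x == lev t])%:R <= 4 * r * s%:R + 1.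
  move=> sat; rewrite big_nat_recr//= {2}/regular -/st sat eqxx/=.
  rewrite filter_rcons eqxx size_rcons addn1.
  have [_] := H (lev t); rewrite -(ES (site t)) sat => /(_ isT)[-> h]; split=> //.
  by rewrite -natr1 lerD2r ltW.
case: stepP => [sat D|sat D st2|sat h|sat h1 h2|sat h1 h2] /=.
- split=> // j; have [jt|jt] := eqVneq (lev t) j.
    by have [E1 E2] := Hnew sat; rewrite -jt E1.
  by rewrite H' ?jt; [|by right]; rewrite filter_rcons (negbTE jt); apply: H.
- split=> [z j|j]; first by rewrite ES.
  have [jt|jt] := eqVneq (lev t) j.
    by have [E1 E2] := Hnew sat; rewrite -jt E1.
  rewrite H'; last by right.
  have [h1 h2] := H j; split=> //= /h2[E1 E2]; split=> //.
  rewrite E1 -filter_predI; congr size; rewrite filter_rcons /= (negbTE jt) /=.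
  by apply: eq_filter => x /=; case: eqP => //= ->; rewrite eq_sym jt.
- by split=> //; exact: Hreg.
- by split=> //; exact: Hreg.
- have [_ -> -> ->] := insert_step_fields s key (State (ssat st) (stau st) (pend st) (csat st)
                     (cS st) (clast st) (msgs st).+1) t.
  by split=> //; exact: Hreg.
Qed.

(** Levels below the free cutoff [J] are charged the bound per level; an item of level at least [J]
    has [1 <= w i / r ^+ J] and is charged that amount. *)
Lemma early_le key n J : (forall i, (i < n)%N -> 1 <= w i) ->
  (\sum_(0 <= i < n) ~~ regular s w site key i)%N%:R <=
    J%:R * (4 * r * s%:R + 1) + (\sum_(i < n) w i) / r ^+ J.
Proof.
move=> w1.
apply: (@le_trans _ _ (\sum_(j < J) (\sum_(0 <= i < n) (~~ regular s w site key i && (lev i == j)))%N%:R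
    + (\sum_(i < n) w i) / r ^+ J)); last first.
  rewrite lerD2r mulr_natl -[J in leRHS]card_ord -sumr_const.
  by apply: ler_sum => j _; have [_ /(_ j)[]] := early_per_level key n.
rewrite natr_sum mulr_suml big_mkord.
under [X in _ <= X + _]eq_bigr do rewrite natr_sum big_mkord.
rewrite exchange_big /= -big_split /=; apply: ler_sum => i _.
have /andP[lo _] := level_bounds k s (w1 i (ltn_ord i)).
have wr : 0 <= w i / r ^+ J.
  by apply: divr_ge0; [exact: le_trans (w1 i (ltn_ord i))|exact/ltW/rparX_gt0].
case: (regular s w site key i) => /=; first by rewrite big1// add0r.
have [iJ|Ji] := ltnP (lev i) J.
  rewrite (bigD1 (Ordinal iJ))//= eqxx -addrA lerDl; apply: addr_ge0 => //; exact: sumr_ge0.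
apply: ler_wpDl; first exact: sumr_ge0.
rewrite ler_pdivlMr ?rparX_gt0// mul1r.
by apply: le_trans lo; rewrite ler_weXn2l// ltW// rpar_gt1.
Qed.

(** Saturation needs at least [4 * r * s >= k] pending items, more than have arrived. *)
Lemma run_few_items key t : (t < k)%N ->
  cS (run key t) = [::] /\ forall z j, ssat (run key t) z j = false.
Proof.
elim: t => // t IH tk; have [E1 E2] := IH (ltnW tk); rewrite runS.
have [U Pt _ _] := run_kept w site s0 key t.
have szP : (size (pend (run key t)) <= t)%N.
  rewrite -[leqRHS](size_iota 0); apply: uniq_leq_size => // x /Pt.
  by rewrite mem_iota.
case: stepP => [sat D|sat D st2|sat h|sat h1 h2|sat h1 h2]; try by rewrite E2 in sat.
exfalso; move: D; apply/negP; rewrite -ltNge.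
have rs : k%:R <= 4 * r * s%:R.
  apply: le_trans (leq_rparM R k s0) _; rewrite -mulrA ler_peMl ?ler1n//.
  by rewrite mulr_ge0// ltW// rpar_gt0.
apply: lt_le_trans rs; rewrite ltr_nat size_filter; apply: leq_ltn_trans (count_size _ _) _.
by rewrite size_rcons; apply: leq_ltn_trans tk.
Qed.

Lemma msgs_few_items key n : (n < k)%N -> (msgs (run key n) <= 2 * n)%N.
Proof.
move=> nk; have [[T1 _ _] M] := run_tracked w site s0 key n.
have [E _] := run_few_items key nk.
move: M; rewrite T1 E /jof /uval /= eq_sym eqn0Ngt s0 /= ler10 /= muln0 addn0.
have -> : (\sum_(0 <= i < n) (regular s w site key i && sent s w site key i) = 0)%N.
  rewrite big_nat big1// => i /andP[_ i_n].
  by have [_] := run_few_items key (ltn_trans i_n nk); rewrite /regular => ->.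
have : (\sum_(0 <= i < n) ~~ regular s w site key i <= n)%N.
  rewrite -[leqRHS](subn0 n) -[leqRHS]muln1 -sum_nat_const_nat; apply: leq_sum => i _.
  exact: leq_b1.
lia.
Qed.

(** Distinct keys make the top [minn t s] unambiguous. The work lies in items absent from both [S]
    and the pending list, which are compared through [dominated]. *)
Lemma queryP (key : nat -> R) t : (forall i, (i < t)%N -> 0 < key i) ->
  (forall i j, (i < t)%N -> (j < t)%N -> i != j -> key i != key j) ->
  let Q := query k s w site key t in
  [/\ uniq Q, size Q = minn t s, forall q, q \in Q -> (q < t)%N,
      sorted (fun a b => key b <= key a) Q &
      forall q i, q \in Q -> (i < t)%N -> i \notin Q -> key i < key q].
Proof.
move=> k0 kinj; rewrite /query; set st := run key t.
have [Up Pt [Uc Xc Sc] /(_ k0) Dm] := run_kept w site s0 key t; rewrite -/st in Up Pt Uc Xc Sc Dm.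
set L := cS st ++ pend st.
have UL : uniq L.
  rewrite cat_uniq Uc Up andbT /=; apply/hasPn => x xp; apply/negP => /Xc[_].
  by rewrite xp.
have Lt x : x \in L -> (x < t)%N by rewrite mem_cat => /orP[/Xc[]|/Pt].
have lost i : (i < t)%N -> i \notin L -> size (cS st) = s /\ forall x, x \in cS st -> key i <= key x.
  by move=> it; rewrite mem_cat negb_or => /andP[ic ip]; exact: Dm.
set le := fun a b => _; set Q := take _ _.
have le_tot : total le by move=> a b; rewrite /le; exact: le_total.
have le_tr : transitive le by move=> b a c ab bc; exact: le_trans bc ab.
have so : sorted le (sort le L) by exact: sort_sorted.
(* Either all [t] items are present, or a lost item certifies that [S] is full. *)
have szL : (minn t s <= size L)%N.
  have [h|] := boolP (all (mem L) (iota 0 t)).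
    rewrite geq_min; apply/orP; left; rewrite -[leqLHS](size_iota 0).
    by apply: uniq_leq_size; [exact: iota_uniq|exact/allP].
  move=> /allPn[i]; rewrite mem_iota /= => it /(lost i it)[E _].
  by rewrite size_cat E; lia.
have UQ : uniq Q by rewrite take_uniq// sort_uniq.
have sQ : size Q = minn t s by rewrite size_takel// size_sort.
have QL q : q \in Q -> q \in L by move=> /mem_take; rewrite mem_sort.
have Qtop q i : q \in Q -> i \in L -> i \notin Q -> key i < key q.
  move=> qQ iL iQ.
  have id : i \in drop (minn t s) (sort le L).
    have : i \in sort le L by rewrite mem_sort.
    by rewrite -{1}(cat_take_drop (minn t s) (sort le L)) mem_cat (negbTE iQ).
  have ne : key i != key q.
    by apply: kinj; [exact: Lt|exact/Lt/QL|apply: contraNneq iQ => ->].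
  rewrite lt_neqAle ne /=.
  have : pairwise le (sort le L) by rewrite -sorted_pairwise.
  rewrite -{1}(cat_take_drop (minn t s) (sort le L)) pairwise_cat => /and3P[/allrelP h _ _].
  exact: h.
split=> //; first by move=> q /QL/Lt.
  exact: take_sorted.
move=> q i qQ it iQ; have [iL|iL] := boolP (i \in L); first exact: Qtop.
have [E h] := lost i it iL.
rewrite ltNge; apply/negP => qi.
have neq : key q != key i.
  by apply: kinj => //; [exact/Lt/QL|apply: contraNneq iQ => <-].
have h' x : x \in cS st -> key q < key x.
  by move=> /h; apply: lt_le_trans; rewrite lt_neqAle neq.
(* If a lost item [i] beat [q] in [Q], the [s] members of [S] would all beat [q] and so lie in [Q]
   as well; with [q] they are too many. *)
have sub : {subset q :: cS st <= Q}.
  move=> x; rewrite inE => /predU1P[->//|xc]; apply/negPn/negP => xQ.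
  have := Qtop q x qQ _ xQ; rewrite mem_cat xc => /(_ isT).
  by rewrite ltNge ltW// h'.
have U : uniq (q :: cS st) by rewrite /= Uc andbT; apply/negP => /h'; rewrite ltxx.
by have := uniq_leq_size U sub; rewrite /= E sQ leq_min ltnn andbF.
Qed.

End Saturation.

(** * Measurability of a run *)

Lemma eq_in_sort (T : eqType) (le1 le2 : rel T) (l : seq T) :
  {in l &, le1 =2 le2} -> sort le1 l = sort le2 l.
Proof.
move=> /in2_sig h; case/all_sigP: (allss l) => l' ->; rewrite !sort_map.
by congr (map _ (sort _ _)); apply/funext => a; apply/funext => b; exact: h.
Qed.

Section CountablyMeasurable.
Context {d : measure_display} {Omega : measurableType d}.

(* [f] factors through a measurable map to [nat]; these maps are closed under
   the monadic bind below, which is how the state of a run is shown to be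
   measurable although [state] carries no sigma-algebra. *)
Definition cmeas {X : Type} (f : Omega -> X) : Prop :=
  exists (g : Omega -> nat) (h : nat -> X),
    (forall m, measurable [set om | g om = m]) /\ forall om, f om = h (g om).

Lemma cmeas_preimage {X : Type} (f : Omega -> X) (Q : X -> Prop) : cmeas f ->
  measurable [set om | Q (f om)].
Proof.
move=> [g [h [mg E]]].
have -> : [set om | Q (f om)] =
    \bigcup_m (if `[< Q (h m) >] then [set om | g om = m] else set0).
  apply/seteqP; split=> om /=.
    by move=> q; exists (g om) => //; rewrite -E asboolT.
  by move=> [m _]; case: asboolP => // q /= gm; rewrite E gm.
by apply: bigcup_measurable => m _; case: ifP.
Qed.

Lemma cmeas_ext {X : Type} (f f' : Omega -> X) : (forall om, f om = f' om) ->
  cmeas f -> cmeas f'.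
Proof. by move=> /funext ->. Qed.

Lemma cmeas_cst {X : Type} (x : X) : cmeas (fun=> x).
Proof.
exists (fun=> 0%N), (fun=> x); split=> // m.
by have [->|m0] := eqVneq m 0%N; [rewrite (_ : [set _ | _] = setT)//; apply/seteqP
 |rewrite (_ : [set _ | _] = set0)//; apply/seteqP; split=> // om /= h; rewrite h eqxx in m0].
Qed.

Lemma cmeas_bool (b : Omega -> bool) : measurable [set om | b om] -> cmeas b.
Proof.
move=> mb; exists (fun om => nat_of_bool (b om)), (fun m => m == 1%N); split; last first.
  by move=> om; case: (b om).
have mb' : measurable [set om | ~~ b om].
  rewrite (_ : [set _ | _] = ~` [set om | b om]); first exact: measurableC.
  by apply/seteqP; split=> om /=; case: (b om).
move=> [|[|m]].
- by rewrite (_ : [set _ | _] = [set om | ~~ b om])//; apply/seteqP; split=> om /=; case: (b om).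
- by rewrite (_ : [set _ | _] = [set om | b om])//; apply/seteqP; split=> om /=; case: (b om).
- by rewrite (_ : [set _ | _] = set0)//; apply/seteqP; split=> om //=; case: (b om).
Qed.

(** Choice fixes one factorisation of [F (h m)] per code [m]; the pair of the code of [f] and the
    resulting second code is packed into one natural number. *)
Lemma cmeas_bind {X Y : Type} (f : Omega -> X) (F : X -> Omega -> Y) :
  cmeas f -> (forall x, cmeas (F x)) -> cmeas (fun om => F (f om) om).
Proof.
move=> [g [h [mg E]]] mF.
have /choice[G HG] : forall m, exists gh : (Omega -> nat) * (nat -> Y),
    (forall p, measurable [set om | gh.1 om = p]) /\ forall om, F (h m) om = gh.2 (gh.1 om).
  by move=> m; have [g' [h' H]] := mF (h m); exists (g', h').
exists (fun om => pickle (g om, (G (g om)).1 om)).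
exists (fun c => let p := odflt (0%N, 0%N) (unpickle c) in (G p.1).2 p.2).
split; last by move=> om; rewrite pickleK /= E; apply: (HG _).2.
move=> m; rewrite (_ : [set _ | _] = \bigcup_a \bigcup_b
    (if pickle (a, b) == m then [set om | g om = a] `&` [set om | (G a).1 om = b] else set0)).
  apply: bigcup_measurable => a _; apply: bigcup_measurable => b _.
  by case: ifP => // _; apply: measurableI => //; apply: (HG _).1.
apply/seteqP; split=> om /=.
  by move=> E'; exists (g om) => //; exists ((G (g om)).1 om) => //; rewrite E' eqxx.
by move=> [a _ [b _]]; case: eqP => //= <- [-> ->].
Qed.

Lemma cmeas_comp {X Y : Type} (f : Omega -> X) (F : X -> Y) :
  cmeas f -> cmeas (fun om => F (f om)).
Proof. by move=> mf; apply: (cmeas_bind (F := fun x _ => F x) mf) => x; exact: cmeas_cst. Qed.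

Lemma cmeas_if {X : Type} (b : Omega -> bool) (f f' : Omega -> X) :
  cmeas b -> cmeas f -> cmeas f' -> cmeas (fun om => if b om then f om else f' om).
Proof.
move=> mb mf mf'.
by apply: (cmeas_bind (F := fun c om => if c then f om else f' om) mb) => -[].
Qed.

End CountablyMeasurable.

Section RunMeasurable.
Context {d : measure_display} {Omega : measurableType d} {R : realType}.
Variables (k s : nat) (w : nat -> R) (site : nat -> 'I_k) (key : Omega -> nat -> R).
Hypothesis mkey : forall i, measurable_fun setT (fun om => key om i).

Lemma cmeas_lt (f g : Omega -> R) : measurable_fun setT f -> measurable_fun setT g ->
  cmeas (fun om => f om < g om).
Proof.
move=> mf mg; apply: cmeas_bool.
have := measurable_fun_ltr mf mg => /(_ measurableT [set true] I).
by rewrite setTI.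
Qed.

Lemma cmeas_le (f g : Omega -> R) : measurable_fun setT f -> measurable_fun setT g ->
  cmeas (fun om => f om <= g om).
Proof.
move=> mf mg; apply: cmeas_ext (cmeas_comp negb (cmeas_lt mg mf)) => om.
by rewrite leNgt.
Qed.

Lemma cmeas_level (f : Omega -> R) : measurable_fun setT f ->
  cmeas (fun om => level k s (f om)).
Proof.
move=> mf; rewrite /level.
have mq : measurable_fun setT (fun om => ln (f om) / ln (@rpar R k s)).
  apply: measurable_funM; last exact: measurable_cst.
  exact: measurableT_comp (@measurable_ln R) mf.
set q := fun om => _ in mq.
suff : cmeas (fun om => Num.floor (q om)) by move=> /(cmeas_comp (fun z : int => `|z|%N)).
have mz (z : int) : measurable [set om | Num.floor (q om) = z].
  rewrite (_ : [set _ | _] = [set om | z%:~R <= q om] `&` [set om | q om < (z + 1)%:~R]).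
    apply: measurableI.
      by apply: (cmeas_preimage is_true); apply: cmeas_le.
    by apply: (cmeas_preimage is_true); apply: cmeas_lt.
  apply/seteqP; split=> om /=.
    by move=> <-; apply/andP; exact: floor_itv.
  by move=> [a b]; apply/eqP; rewrite floor_eq a b.
exists (fun om => pickle (Num.floor (q om))), (fun m => odflt 0 (unpickle m)).
split; last by move=> om; rewrite pickleK.
move=> m; rewrite (_ : [set _ | _] = \bigcup_(z in [set z : int | pickle z = m])
   [set om | Num.floor (q om) = z]); last first.
  apply/seteqP; split=> om /=; first by move=> h; exists (Num.floor (q om)).
  by move=> [z /= <- ->].
case: (pselect (exists z : int, pickle z = m)) => [[z zm]|nz].
  rewrite (_ : [set z | _] = [set z]) ?bigcup_set1//.
  apply/seteqP; split=> y /=; last by move=> ->.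
  by rewrite -zm => /(pcan_inj pickleK).
rewrite (_ : [set z | _] = set0) ?bigcup_set0//.
by apply/seteqP; split=> y //= h; apply: nz; exists y.
Qed.

Lemma cmeas_minitem S : cmeas (fun om => minitem (key om) S).
Proof.
rewrite /minitem; move: (head 0%N S) => h; elim: S => [|x l IH] /=; first exact: cmeas_cst.
apply: (cmeas_bind (F := fun m om => if key om x < key om m then x else m) IH) => m.
by apply: cmeas_if; [exact: cmeas_lt|exact: cmeas_cst|exact: cmeas_cst].
Qed.

Lemma cmeas_insertS S x : cmeas (fun om => insertS s (key om) S x).
Proof.
rewrite /insertS; cbv zeta; case: (s < size (x :: S))%N; last exact: cmeas_cst.
exact: cmeas_comp (fun m => rem m (x :: S)) (cmeas_minitem _).
Qed.

Lemma cmeas_jof S : cmeas (fun om => jof k s (key om) S).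
Proof.
rewrite /jof /uval; case: (size S == s).
  apply: (cmeas_bind (F := fun m om => if 1 <= key om m then Some (level k s (key om m)) else None)
    (cmeas_minitem S)) => m.
  apply: cmeas_if; [exact: cmeas_le| |exact: cmeas_cst].
  by apply: cmeas_comp; exact: cmeas_level.
exact: cmeas_cst.
Qed.

Lemma cmeas_insert_step (st : state R k) x : cmeas (fun om => insert_step s (key om) st x).
Proof.
rewrite /insert_step.
apply: (cmeas_bind (F := fun S' om => match jof k s (key om) S' with
  | Some j =>
      if jof k s (key om) S' != clast st then
        State (ssat st) (fun _ => rpar k s ^+ j) (pend st) (csat st) S' (jof k s (key om) S') (msgs st + k)
      else State (ssat st) (stau st) (pend st) (csat st) S' (jof k s (key om) S') (msgs st)
  | None => State (ssat st) (stau st) (pend st) (csat st) S' (jof k s (key om) S') (msgs st)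
  end) (cmeas_insertS (cS st) x)) => S'.
exact: cmeas_comp (fun c => match c with
  | Some j =>
      if c != clast st then
        State (ssat st) (fun _ => rpar k s ^+ j) (pend st) (csat st) S' c (msgs st + k)
      else State (ssat st) (stau st) (pend st) (csat st) S' c (msgs st)
  | None => State (ssat st) (stau st) (pend st) (csat st) S' c (msgs st)
  end) (cmeas_jof S').
Qed.

Lemma cmeas_foldl_insert (st : state R k) D :
  cmeas (fun om => foldl (insert_step s (key om)) st D).
Proof.
elim: D st => [|x D IH] st /=; first exact: cmeas_cst.
by apply: (cmeas_bind (F := fun st' om => foldl (insert_step s (key om)) st' D)
  (cmeas_insert_step st x)).
Qed.

Lemma cmeas_step (st : state R k) i : cmeas (fun om => step s w site (key om) st i).
Proof.
rewrite /step /=; case: (ssat st (site i) (level k s (w i))) => /=; last first.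
  case: (4%:R * rpar k s * s%:R <= _); last exact: cmeas_cst.
  exact: cmeas_comp (fun st2 => State
       (fun z' j' => (j' == level k s (w i)) || ssat st2 z' j') (stau st2)
            [seq x <- pend st2 | level k s (w x) != level k s (w i)]
            (fun j' => (j' == level k s (w i)) || csat st2 j')
            (cS st2) (clast st2) (msgs st2 + k)) (cmeas_foldl_insert _ _).
apply: cmeas_if; [exact: cmeas_lt| |exact: cmeas_cst].
apply: cmeas_if; [|exact: cmeas_insert_step|exact: cmeas_cst].
rewrite /uval; case: (size (cS st) == s); last exact: cmeas_lt.
apply: (cmeas_bind (F := fun m om => key om m < key om i) (cmeas_minitem _)) => m.
exact: cmeas_lt.
Qed.

Lemma cmeas_run t : cmeas (fun om => run k s w site (key om) t).
Proof.
elim: t => [|t IH]; first exact: cmeas_cst.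
apply: (cmeas_ext (f := fun om => step s w site (key om) (run k s w site (key om) t) t)).
  by move=> om; rewrite runS.
by apply: (cmeas_bind (F := fun st om => step s w site (key om) st t) IH) => st; exact: cmeas_step.
Qed.

(** Sorting depends on the real keys only through the finite table of comparisons between members of
    [l], and that table factors through [nat]. *)
Lemma cmeas_merge_sort (l : seq nat) :
  cmeas (fun om => sort (fun a b => key om b <= key om a) l).
Proof.
pose tab om := [seq [seq key om b <= key om a | b <- l] | a <- l].
have mtab : cmeas tab.
  rewrite /tab; elim: {2}l => [|a l' IH] /=; first exact: cmeas_cst.
  have mrow : cmeas (fun om => [seq key om b <= key om a | b <- l]).
    elim: {1}l => [|b l2 IH2] /=; first exact: cmeas_cst.
    have mle : cmeas (fun om => key om b <= key om a) by exact: cmeas_le.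
    apply: (cmeas_bind (F := fun c om => c :: [seq key om b <= key om a | b <- l2]) mle) => c.
    exact: cmeas_comp (fun r => c :: r) IH2.
  apply: (cmeas_bind (F := fun r om => r :: [seq [seq key om b <= key om a | b <- l] | a <- l'])
    mrow) => row.
  exact: cmeas_comp (fun r => row :: r) IH.
apply: (cmeas_ext (f := fun om => sort (fun a b => nth false (nth [::] (tab om) (index a l)) (index b l)) l)).
  move=> om; apply: eq_in_sort => a b al bl.
  rewrite /tab (nth_map 0%N) ?index_mem// (nth_map 0%N) ?index_mem//.
  by rewrite !nth_index.
exact: cmeas_comp (fun tb => sort (fun a b => nth false (nth [::] tb (index a l)) (index b l)) l) mtab.
Qed.

Lemma cmeas_query t : cmeas (fun om => query k s w site (key om) t).
Proof.
rewrite /query.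
apply: (cmeas_bind (F := fun st om => take (minn t s)
  (sort (fun a b => key om b <= key om a) (cS st ++ pend st))) (cmeas_run t)) => st.
exact: cmeas_comp (take (minn t s)) (cmeas_merge_sort _).
Qed.

End RunMeasurable.

(** * Independence and the exponential law *)

Section ExponentialIncrements.
Variable R : realType.

(** The lower bound combines [(1 + x) * expR (- x) <= 1] with
    [(1 + x) * (1 - x + x ^+ 2) = 1 + x ^+ 3]. *)
Lemma expRN_bounds (x : R) : 0 <= x -> x - x ^+ 2 <= 1 - expR (- x) <= x.
Proof.
move=> x0; have h1 := expR_ge1Dx (- x); have h2 := expR_ge1Dx x.
have e0 := expR_gt0 (- x); have E : expR x * expR (- x) = 1 by rewrite expRxMexpNx_1.
apply/andP; split; last by lra.
have : (1 + x) * expR (- x) <= 1 by rewrite -[leRHS]E; apply: ler_wpM2r => //; exact: ltW.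
rewrite -subr_ge0 => h.
have : 0 <= (1 + x) * (1 - x + x ^+ 2 - expR (- x)).
  rewrite (_ : _ * _ = (1 - (1 + x) * expR (- x)) + x * x * x); last by ring.
  by rewrite addr_ge0// !mulr_ge0.
by rewrite pmulr_rge0 => [hh|]; lra.
Qed.

(** Quadratically small increments force [D] to be constant, and decay forces that constant to be 0;
    the proof is quantitative and uses no derivative. *)
Lemma small_increments_eq (D : R -> R) (K c a : R) : 0 < a -> 0 <= K -> 0 <= c ->
  (forall x h, 0 <= x -> 0 < h -> `|D x - D (x + h)| <= K * h ^+ 2) ->
  (forall x, 0 <= x -> `|D x| <= c * expR (- (a * x))) ->
  forall x, 0 <= x -> D x = 0.
Proof.
move=> a0 K0 c0 H1 H2 x x0.
have steps h m : 0 < h -> `|D x - D (x + m%:R * h)| <= m%:R * (K * h ^+ 2).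
  move=> h0; elim: m => [|m IH]; first by rewrite !mul0r addr0 subrr normr0.
  have m0 : 0 <= x + m%:R * h by rewrite addr_ge0// mulr_ge0// ltW.
  have := H1 _ _ m0 h0.
  have -> : x + m%:R * h + h = x + m.+1%:R * h by rewrite -natr1; ring.
  move=> H.
  rewrite -(subrKA (D (x + m%:R * h))).
  apply: le_trans (ler_normD _ _) _.
  rewrite [leRHS](_ : _ = m%:R * (K * h ^+ 2) + K * h ^+ 2); first exact: lerD.
  by rewrite -natr1; ring.
have key m : (0 < m)%N -> `|D x| * m%:R <= K + c / a.
  move=> m0; have mR : 0 < m%:R :> R by rewrite ltr0n.
  (* Taking [m ^ 3] steps of length [1 / m ^ 2] covers distance [m] with total error [K / m], and
     the decay at that distance leaves at most [c / (a * m)]. *)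
  pose h := (m%:R ^+ 2)^-1 : R.
  have h0 : 0 < h by rewrite invr_gt0 exprn_gt0.
  have := steps h (m ^ 3)%N h0; rewrite natrX.
  have -> : m%:R ^+ 3 * h = m%:R by rewrite /h exprS mulfK// gt_eqF// exprn_gt0.
  have -> : m%:R ^+ 3 * (K * h ^+ 2) = K / m%:R.
    by rewrite /h; field; rewrite gt_eqF.
  move=> S1; have xm : 0 <= x + m%:R by rewrite addr_ge0.
  have S2 := H2 _ xm.
  have S3 : c * expR (- (a * (x + m%:R))) <= c / a / m%:R.
    rewrite -mulrA ler_wpM2l// -invfM expRN lef_pV2 ?posrE ?expR_gt0 ?mulr_gt0//.
    apply: le_trans (expR_ge1Dx _); rewrite mulrDr.
    have : 0 <= a * x by rewrite mulr_ge0// ltW.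
    lra.
  have : `|D x| <= (K + c / a) / m%:R.
    rewrite mulrDl; apply: le_trans (lerD S1 (le_trans S2 S3)).
    by rewrite -{1}(subrK (D (x + m%:R)) (D x)) ler_normD.
  by rewrite ler_pdivlMr.
apply/eqP; rewrite -normr_eq0; apply/negPn/negP => D0.
have Dp : 0 < `|D x| by rewrite lt_def D0 normr_ge0.
have := key (Num.truncn ((K + c / a) / `|D x|)).+1 isT.
by rewrite leNgt -ltr_pdivrMl// mulrC; apply/negP/negPn; exact: truncnS_gt.
Qed.

(* A function whose increments are pinched like those of
   [x |-> P(x < X_a < min of the others)] is that exponential. *)
Lemma exp_increments (F : R -> R) (a b c : R) : 0 < a -> 0 <= b -> 0 <= c ->
  (forall x h, 0 <= x -> 0 < h ->
    c * (expR (- (a * x)) - expR (- (a * (x + h)))) * expR (- (b * (x + h))) <= F x - F (x + h)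
      <= c * (expR (- (a * x)) - expR (- (a * (x + h)))) * expR (- (b * x))) ->
  (forall x, 0 <= x -> 0 <= F x <= expR (- (a * x))) ->
  forall x, 0 <= x -> F x = c * (a / (a + b)) * expR (- ((a + b) * x)).
Proof.
move=> a0 b0 c0 H1 H2 x x0.
have ab0 : 0 < a + b by lra.
pose G x := c * (a / (a + b)) * expR (- ((a + b) * x)).
apply/eqP; rewrite -subr_eq0; apply/eqP.
(* The increments of [F] and [G] both lie in an interval of length [c * E * a * (a + b) * h ^+ 2]
   with [E <= 1], which gives the first constant. The factor [1 + c] adds the decay bounds of [F]
   and [G]. *)
apply: (@small_increments_eq (fun x => F x - G x) (c * a * (a + b)) (1 + c) a _ _ _ _ _ x x0) => //.
- by rewrite !mulr_ge0// ltW.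
- by rewrite addr_ge0.
- move=> {x0}x {}h x0 h0.
  set E := expR (- ((a + b) * x)).
  have E0 : 0 < E by exact: expR_gt0.
  have E1 : E <= 1 by rewrite expR_le1 oppr_le0 mulr_ge0// ltW.
  have EE : E = expR (- (a * x)) * expR (- (b * x)) by rewrite -expRD; congr expR; ring.
  have split1 : expR (- (a * (x + h))) = expR (- (a * x)) * expR (- (a * h)).
    by rewrite -expRD; congr expR; ring.
  have split2 : expR (- (b * (x + h))) = expR (- (b * x)) * expR (- (b * h)).
    by rewrite -expRD; congr expR; ring.
  have split3 : expR (- ((a + b) * (x + h))) = E * expR (- ((a + b) * h)).
    by rewrite -expRD; congr expR; ring.
  have ah0 : 0 <= a * h by rewrite mulr_ge0// ltW.
  have bh0 : 0 <= b * h by rewrite mulr_ge0// ltW.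
  have abh0 : 0 <= (a + b) * h by rewrite mulr_ge0// ltW.
  have /andP[A1 A2] := expRN_bounds ah0.
  have /andP[B1 B2] := expRN_bounds bh0.
  have /andP[C1 C2] := expRN_bounds abh0.
  have /andP[L U] := H1 _ _ x0 h0.
  set ea := expR (- (a * h)) in A1 A2 split1 *.
  set eb := expR (- (b * h)) in B1 B2 split2 *.
  have cE0 : 0 <= c * E by rewrite mulr_ge0// ltW.
  have U' : F x - F (x + h) <= c * E * (a * h).
    apply: le_trans U _; rewrite split1.
    rewrite (_ : _ * _ = c * E * (1 - ea)); last by rewrite EE; ring.
    exact: ler_wpM2l.
  have L' : c * E * (a * h - a * (a + b) * h ^+ 2) <= F x - F (x + h).
    apply: le_trans L; rewrite split1 split2.
    rewrite (_ : c * _ * (expR _ * eb) = c * E * ((1 - ea) * eb)); last by rewrite EE; ring.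
    apply: ler_wpM2l => //.
    have ea1 : 0 <= 1 - ea by rewrite subr_ge0 expR_le1 oppr_le0.
    have : (1 - ea) * (1 - eb) <= (a * h) * (b * h).
      by apply: ler_pM => //; rewrite subr_ge0 expR_le1 oppr_le0.
    rewrite (_ : (1 - ea) * (1 - eb) = (1 - ea) - (1 - ea) * eb); last by ring.
    rewrite (_ : a * (a + b) * h ^+ 2 = (a * h) ^+ 2 + (a * h) * (b * h)); last by ring.
    lra.
  have GE : G x - G (x + h) = c * E * (a / (a + b)) * (1 - expR (- ((a + b) * h))).
    by rewrite /G split3 -/E; ring.
  have cEa : 0 <= c * E * (a / (a + b)) by rewrite mulr_ge0// divr_ge0// ltW.
  have UG : G x - G (x + h) <= c * E * (a * h).
    rewrite GE; apply: le_trans (ler_wpM2l cEa C2) _.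
    by rewrite le_eqVlt; apply/orP; left; apply/eqP; field; rewrite gt_eqF.
  have LG : c * E * (a * h - a * (a + b) * h ^+ 2) <= G x - G (x + h).
    rewrite GE; apply: le_trans (ler_wpM2l cEa C1).
    by rewrite le_eqVlt; apply/orP; left; apply/eqP; field; rewrite gt_eqF.
  have -> : F x - G x - (F (x + h) - G (x + h)) = (F x - F (x + h)) - (G x - G (x + h)) by ring.
  have : c * E * (a * (a + b) * h ^+ 2) <= c * a * (a + b) * h ^+ 2.
    rewrite (_ : c * E * _ = E * (c * a * (a + b) * h ^+ 2)); last by ring.
    by rewrite ler_piMl// !mulr_ge0 ?sqr_ge0// ltW.
  rewrite ler_norml; move: U' L' UG LG; rewrite mulrBr; lra.
- move=> {x0}x x0; have /andP[f0 f1] := H2 _ x0.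
  rewrite mulrDl mul1r; apply: le_trans (ler_normB _ _) _; apply: lerD.
    by rewrite ger0_norm.
  have h1 : expR (- ((a + b) * x)) <= expR (- (a * x)).
    by rewrite ler_expR lerN2 ler_wpM2r// lerDl.
  have q1 : a / (a + b) <= 1 by rewrite ler_pdivrMr// mul1r lerDl.
  have q0 : 0 <= a / (a + b) by rewrite divr_ge0// ltW.
  rewrite ger0_norm /G; last by apply: mulr_ge0; [exact: mulr_ge0|exact: expR_ge0].
  rewrite -mulrA; apply: ler_wpM2l => //; apply: le_trans h1.
  by apply: ler_piMl => //; exact: expR_ge0.
Qed.

End ExponentialIncrements.

(** * Probabilities as real numbers *)

Section RealProbability.
Context {R : realType} {d : measure_display} {Omega : measurableType d}.
Variable P : probability Omega R.

Definition Pr (A : set Omega) : R := fine (P A).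

Lemma PrE A : measurable A -> P A = (Pr A)%:E.
Proof. by move=> mA; rewrite /Pr fineK// fin_num_measure. Qed.

Lemma Pr_ge0 A : 0 <= Pr A.
Proof. exact: fine_ge0. Qed.

Lemma PrT : Pr setT = 1.
Proof. by rewrite /Pr probability_setT. Qed.

Lemma Pr0 : Pr set0 = 0.
Proof. by rewrite /Pr measure0. Qed.

Lemma PrU A B : measurable A -> measurable B -> A `&` B = set0 ->
  Pr (A `|` B) = Pr A + Pr B.
Proof.
move=> mA mB AB; apply: EFin_inj.
by rewrite EFinD -!PrE//; [exact: measureU|exact: measurableU].
Qed.

Lemma Pr_split A B : measurable A -> measurable B ->
  Pr A = Pr (A `&` B) + Pr (A `&` ~` B).
Proof.
move=> mA mB; rewrite -PrU.
- by rewrite -setIUr setUv setIT.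
- exact: measurableI.
- by apply: measurableI => //; exact: measurableC.
- by rewrite setIACA setICr setI0.
Qed.

Lemma Pr_le A B : measurable A -> measurable B -> A `<=` B -> Pr A <= Pr B.
Proof.
move=> mA mB AB; rewrite (Pr_split mB mA) (_ : B `&` A = A) ?lerDl ?Pr_ge0//.
by rewrite setIC; exact/setIidPl.
Qed.

Lemma PrC A : measurable A -> Pr (~` A) = 1 - Pr A.
Proof.
by move=> mA; rewrite -PrT (Pr_split measurableT mA) !setTI addrC addKr.
Qed.

Lemma Pr_le1 A : measurable A -> Pr A <= 1.
Proof. by move=> mA; rewrite -PrT; apply: Pr_le. Qed.

Lemma PrIfull A B : measurable A -> measurable B -> Pr B = 1 -> Pr (A `&` B) = Pr A.
Proof.
move=> mA mB B1; rewrite (Pr_split mA mB); apply/eqP.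
rewrite -subr_eq0 opprD addrA subrr sub0r oppr_eq0; apply/eqP/le_anti.
rewrite Pr_ge0 andbT -(subrr 1) -{2}B1 -PrC//; apply: Pr_le.
- by apply: measurableI => //; exact: measurableC.
- exact: measurableC.
- by move=> om [].
Qed.

Lemma measurable_preim (X : {RV P >-> R}) (B : set R) :
  measurable B -> measurable (X @^-1` B).
Proof. by move=> mB; rewrite -[Y in measurable Y]setTI; exact: measurable_funP. Qed.

Lemma Pr_has (I : eqType) (E : I -> Omega -> bool) (l : seq I) : uniq l ->
  (forall i, measurable [set om | E i om]) ->
  (forall i j om, i \in l -> j \in l -> E i om -> E j om -> i = j) ->
  Pr [set om | has (E^~ om) l] = \sum_(i <- l) Pr [set om | E i om].
Proof.
move=> + mE; elim: l => [|a l IH] /=.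
  by move=> _ _; rewrite big_nil (_ : [set _ | _] = set0) ?Pr0//; apply/seteqP; split=> om.
move=> /andP[al U] H; rewrite big_cons -IH//; last first.
  by move=> i j om il jl; apply: H; rewrite inE ?il ?jl orbT.
have mh : measurable [set om | has (E^~ om) l].
  elim: {al U H IH} l => [|b l IH] /=; first by rewrite (_ : [set _ | _] = set0)//; apply/seteqP; split=> om.
  rewrite (_ : [set _ | _] = [set om | E b om] `|` [set om | has (E^~ om) l]).
    exact: measurableU.
  by apply/seteqP; split=> om /=; [move/orP|move=> h; apply/orP].
rewrite -PrU//.
  by congr Pr; apply/seteqP; split=> om /=; [move/orP|move=> h; apply/orP].
apply/seteqP; split=> // om [/= Ea /hasP[j jl Ej]].
have := H a j om; rewrite mem_head inE jl orbT => /(_ isT isT Ea Ej) aj.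
by rewrite aj jl in al.
Qed.

End RealProbability.

(** * Boxes and events of the past *)

Section Independence.
Context {R : realType} {d : measure_display} {Omega : measurableType d}.
Variables (P : probability Omega R) (n : nat) (T : nat -> {RV P >-> R}).
Hypothesis indep : mutually_independent n T.
Local Notation Pr := (Pr P).

Definition box (B : nat -> set R) : set Omega :=
  [set om | forall i, (i < n)%N -> B i (T i om)].

Definition upd (B : nat -> set R) (a : nat) (I : set R) : nat -> set R :=
  fun i => if i == a then I else B i.

Lemma mbox B : (forall i, measurable (B i)) -> measurable (box B).
Proof.
move=> mB; rewrite (_ : box B = \bigcap_(i in `I_n) (T i @^-1` B i)).
  by apply: fin_bigcap_measurable => // i _; exact: measurable_preim.
by apply/seteqP; split=> om h i; apply: h.
Qed.

Lemma Pr_box B : (forall i, measurable (B i)) ->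
  Pr (box B) = \prod_(i < n) Pr (T i @^-1` B i).
Proof.
move=> mB; apply: EFin_inj; rewrite -PrE; last exact: mbox.
rewrite -prodEFin; under eq_bigr => i _ do rewrite -(PrE P (measurable_preim (T i) (mB i))).
rewrite -(indep (B := fun i : 'I_n => B i))//; congr (P _).
by apply/seteqP; split=> om h i; [apply: h|move=> i_n; exact: (h (Ordinal i_n))].
Qed.

Lemma box_upd B a I : (a < n)%N -> B a = setT ->
  box (upd B a I) = box B `&` (T a @^-1` I).
Proof.
move=> an Ba; apply/seteqP; split=> om.
  move=> h; split; last by have := h a an; rewrite /upd eqxx.
  move=> i i_n; have := h i i_n; rewrite /upd; case: eqP => // -> _.
  by rewrite Ba.
by move=> [h hI] i i_n; rewrite /upd; case: eqP => [->//|_]; exact: h.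
Qed.

Lemma upd_measurable B a I : (forall i, measurable (B i)) -> measurable I ->
  forall i, measurable (upd B a I i).
Proof. by move=> mB mI i; rewrite /upd; case: ifP. Qed.

Lemma Pr_box_upd B a I : (a < n)%N -> B a = setT -> (forall i, measurable (B i)) ->
  measurable I -> Pr (box (upd B a I)) = Pr (box B) * Pr (T a @^-1` I).
Proof.
move=> an Ba mB mI; rewrite !Pr_box//; last exact: upd_measurable.
rewrite (bigD1 (Ordinal an))//= [in RHS](bigD1 (Ordinal an))//=.
rewrite /upd eqxx Ba preimage_setT PrT mul1r mulrC; congr (_ * _).
apply: eq_bigr => i /negbTE; rewrite -val_eqE /= => ->.
by [].
Qed.

Lemma Pr_boxT : Pr (box (fun=> setT)) = 1.
Proof. by rewrite (_ : box _ = setT) ?PrT//; apply/seteqP. Qed.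

(* [E] is an event about [T 0, ..., T (m - 1)], phrased through its independence
   of the remaining variables. *)
Definition past (m : nat) (E : set Omega) : Prop := measurable E /\
  forall B, (forall i, measurable (B i)) -> (forall i, (i < m)%N -> B i = setT) ->
    Pr (E `&` box B) = Pr E * Pr (box B).

Lemma past_set0 m : past m set0.
Proof. by split=> // B _ _; rewrite set0I Pr0 mul0r. Qed.

Lemma past_setT m : past m setT.
Proof. by split=> // B _ _; rewrite setTI PrT mul1r. Qed.

(** One node of a decision tree: [T m] selects which earlier event must hold. Trees of this kind
    generate the counting events needed later. *)
Lemma past_branch m E1 E2 I : (m < n)%N -> past m E1 -> past m E2 -> measurable I ->
  past m.+1 ((E1 `&` (T m @^-1` I)) `|` (E2 `&` (T m @^-1` ~` I))).
Proof.
move=> mn [mE1 H1] [mE2 H2] mI.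
have mIc : measurable (~` I) by exact: measurableC.
have M1 : measurable (E1 `&` (T m @^-1` I)) by apply: measurableI => //; exact: measurable_preim.
have M2 : measurable (E2 `&` (T m @^-1` ~` I)) by apply: measurableI => //; exact: measurable_preim.
have disj : (E1 `&` (T m @^-1` I)) `&` (E2 `&` (T m @^-1` ~` I)) = set0.
  by rewrite setIACA -preimage_setI setICr ?preimage_set0 setI0.
(* The factor in front of [Pr (box B)] is explicit and free of [B]; the trivial box then identifies
   it as the probability of the union. *)
have key B : (forall i, measurable (B i)) -> (forall i, (i < m.+1)%N -> B i = setT) ->
  Pr (((E1 `&` (T m @^-1` I)) `|` (E2 `&` (T m @^-1` ~` I))) `&` box B) =
  (Pr E1 * Pr (T m @^-1` I) + Pr E2 * Pr (T m @^-1` ~` I)) * Pr (box B).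
  move=> mB hB; have mb := mbox mB.
  rewrite setIUl PrU; last 3 first.
  - exact: measurableI.
  - exact: measurableI.
  - by rewrite setIACA disj set0I.
  have half E J : measurable J -> (past m E) ->
      Pr (E `&` (T m @^-1` J) `&` box B) = Pr E * Pr (T m @^-1` J) * Pr (box B).
    move=> mJ [mE H]; rewrite -setIA [_ `&` box B]setIC -(box_upd J mn (hB m (ltnSn m))).
    rewrite H ?Pr_box_upd ?hB//; first by ring.
      exact: upd_measurable.
    by move=> i im; rewrite /upd (ltn_eqF im) hB// ltnW.
  by rewrite !half//; ring.
split; first exact: measurableU.
move=> B mB hB; rewrite key//; congr (_ * _).
have := key (fun=> setT); rewrite Pr_boxT mulr1 => <-//.
by congr Pr; rewrite (_ : box _ = setT) ?setIT//; apply/seteqP.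
Qed.

Lemma past_indep m E I : (m < n)%N -> past m E -> measurable I ->
  Pr (E `&` (T m @^-1` I)) = Pr E * Pr (T m @^-1` I).
Proof.
move=> mn [mE H] mI.
have := H (upd (fun=> setT) m I); rewrite box_upd//.
rewrite (_ : box (fun=> setT) = setT) ?setTI; last by apply/seteqP.
apply; first exact: upd_measurable.
by move=> i im; rewrite /upd (ltn_eqF im).
Qed.

End Independence.

Section ExponentialLaw.
Context {R : realType} {d : measure_display} {Omega : measurableType d}.
Variables (P : probability Omega R) (X : {RV P >-> R}).
Hypothesis expX : exp1_distributed X.
Local Notation Pr := (Pr P).

Lemma Pr_exp_gt (x : R) : 0 <= x -> Pr (X @^-1` [set` `]x, +oo[]) = expR (- x).
Proof.
have neg : Pr (X @^-1` [set` `]-oo, (0:R)[]) = 0.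
  rewrite /Pr expX// /exponential_prob integral0_eq// => y /=.
  by rewrite in_itv /= => y0; rewrite lt0_exponential_pdf.
have pos y : 0 < y -> Pr (X @^-1` [set` `]y, +oo[]) = expR (- y).
  move=> y0.
  have -> : [set` `]y, +oo[] = ~` ([set` `]-oo, (0:R)[] `|` [set` `[0, y]]).
    apply/seteqP; split=> z /=; rewrite !in_itv /= ?andbT.
      move=> yz []; rewrite /= ?in_itv /=.
      by move=> z0; have := lt_trans (lt_trans y0 yz) z0; rewrite ltxx.
    by move=> /andP[_ zy]; have := lt_le_trans yz zy; rewrite ltxx.
    move=> h; rewrite ltNge; apply/negP => zy; apply: h.
    by case: (ltP z 0) => z0; [left|right; rewrite zy].
  rewrite -preimage_setC PrC; last by apply: measurable_preim; exact: measurableU.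
  rewrite preimage_setU PrU; last 3 first.
  - exact: measurable_preim.
  - exact: measurable_preim.
  - rewrite -preimage_setI (_ : _ `&` _ = set0) ?preimage_set0//.
    by apply/seteqP; split=> z //= []; rewrite !in_itv /= => z0 /andP[]; rewrite leNgt z0.
  rewrite neg add0r {1}/Pr expX// exponential_prob_itv0c// -EFinB /= mulN1r; ring.
rewrite le_eqVlt => /predU1P[<-|]; last exact: pos.
rewrite oppr0 expR0; apply/le_anti; rewrite Pr_le1/=; last exact: measurable_preim.
(* The endpoint 0 is reached by a limit: [P(X > 0) >= expR (- e) >= 1 - e] for every [e > 0]. *)
apply/ler_addgt0Pr => e e0.
have : Pr (X @^-1` [set` `]e, +oo[]) <= Pr (X @^-1` [set` `]0, +oo[]).
  apply: Pr_le; [exact: measurable_preim|exact: measurable_preim|].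
  by move=> om /=; rewrite !in_itv /= !andbT; exact: lt_trans.
by rewrite pos//; have := expR_ge1Dx (- e); lra.
Qed.

Lemma Pr_exp_oc (x y : R) : 0 <= x -> x <= y ->
  Pr (X @^-1` [set` `]x, y]]) = expR (- x) - expR (- y).
Proof.
move=> x0 xy; rewrite -!Pr_exp_gt//; last exact: le_trans xy.
rewrite (@Pr_split _ _ _ _ (X @^-1` [set` `]x, +oo[]) (X @^-1` [set` `]y, +oo[])); try exact: measurable_preim.
rewrite -preimage_setI preimage_setC -preimage_setI.
have -> : [set` `]x, +oo[] `&` [set` `]y, +oo[] = [set` `]y, +oo[].
  apply/seteqP; split=> z /=; rewrite !in_itv /= !andbT; first by case.
  by move=> yz; split=> //; exact: le_lt_trans yz.
have -> : [set` `]x, +oo[] `&` ~` [set` `]y, +oo[] = [set` `]x, y]].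
  apply/seteqP; split=> z /=; rewrite !in_itv /= !andbT.
    by move=> [-> /negP]; rewrite -leNgt.
  by move=> /andP[-> zy]; split=> //; apply/negP; rewrite -leNgt.
by rewrite addrC addKr.
Qed.

End ExponentialLaw.

(** * Correctness of the query *)

Section Chain.
Variable R : realType.

(** The event that, after time [x], the items of [l] arrive in this order and before all of
    [rest]. *)
Fixpoint chain (X : nat -> R) (x : R) (l rest : seq nat) : bool :=
  if l is a :: l' then (x < X a) && chain X (X a) l' rest
  else all (fun i => x < X i) rest.

Lemma chain_le X x y l rest : x <= y -> chain X y l rest -> chain X x l rest.
Proof.
case: l => [|a l] xy /=.
  by move=> /allP h; apply/allP => i /h; exact: le_lt_trans.
by move=> /andP[ya ->]; rewrite (le_lt_trans xy ya).
Qed.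

Lemma chain_gt X x l rest i : chain X x l rest -> i \in l ++ rest -> x < X i.
Proof.
elim: l x => [|a l IH] x /=; first by move=> /allP; exact.
move=> /andP[xa c]; rewrite inE => /predU1P[->//|/(IH _ c)].
exact: lt_trans.
Qed.

Lemma chain_lt X x l rest q i : chain X x l rest -> q \in l -> i \in rest -> X q < X i.
Proof.
elim: l x => [|a l IH] x //= /andP[xa c]; rewrite inE => /predU1P[->|ql] ir; last exact: IH c ql ir.
by apply: chain_gt c _; rewrite mem_cat ir orbT.
Qed.

Lemma chain_sorted X x l rest : chain X x l rest -> sorted (fun a b => X a < X b) l.
Proof.
case: l => [|a l]//= /andP[_]; elim: l a => [|b l IH] a //= /andP[-> c].
exact: IH c.
Qed.

Lemma chain_uniq_order X x l1 l2 rest : perm_eq l1 l2 ->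
  chain X x l1 rest -> chain X x l2 rest -> l1 = l2.
Proof.
move=> p /chain_sorted s1 /chain_sorted s2.
apply: (irr_sorted_eq (leT := fun a b => X a < X b)) => //.
- by move=> b a c; exact: lt_trans.
- exact: perm_mem.
Qed.

Lemma chainI X x l rest : sorted (fun a b => X a < X b) l ->
  (forall i, i \in l ++ rest -> x < X i) ->
  (forall q i, q \in l -> i \in rest -> X q < X i) -> chain X x l rest.
Proof.
elim: l x => [|a l IH] x /=; first by move=> _ h _; apply/allP.
move=> s1 h1 h2; rewrite h1 ?mem_head//=; apply: IH.
- exact: path_sorted s1.
- move=> i; rewrite mem_cat => /orP[il|ir]; last by apply: h2; rewrite ?mem_head.
  move: s1; rewrite path_sortedE; last by move=> b c e; exact: lt_trans.
  by move=> /andP[/allP + _]; apply.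
- by move=> q i ql; apply: h2; rewrite inE ql orbT.
Qed.

End Chain.

(** * Law of the arrival order *)

Section ChainProbability.
Context {R : realType} {d : measure_display} {Omega : measurableType d}.
Variables (P : probability Omega R) (n : nat) (T : nat -> {RV P >-> R}) (w : nat -> R).
Hypothesis indep : mutually_independent n T.
Hypothesis expT : forall i, (i < n)%N -> exp1_distributed (T i).
Hypothesis w1 : forall i, (i < n)%N -> 1 <= w i.
Local Notation Pr := (Pr P).

Definition arrival (om : Omega) (i : nat) : R := T i om / w i.

Lemma marrival i : measurable_fun setT (fun om => arrival om i).
Proof. by apply: measurable_funM => //; exact: measurable_cst. Qed.

Lemma measurable_lt_fun (f g : Omega -> R) : measurable_fun setT f -> measurable_fun setT g ->
  measurable [set om | f om < g om].
Proof. by move=> mf mg; exact: cmeas_preimage is_true (cmeas_lt mf mg). Qed.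

Lemma measurable_chain f l rest : measurable_fun setT f ->
  measurable [set om | chain (arrival om) (f om) l rest].
Proof.
have mI (b c : Omega -> bool) : measurable [set om | b om] -> measurable [set om | c om] ->
    measurable [set om | b om && c om].
  move=> mb mc; rewrite (_ : [set _ | _] = [set om | b om] `&` [set om | c om]).
    exact: measurableI.
  by apply/seteqP; split=> om /=; [move/andP|move=> h; apply/andP].
elim: l f => [|a l IH] f mf /=.
  elim: rest => [|b rest IH] /=; first by rewrite (_ : [set _ | _] = setT)//; apply/seteqP.
  by apply: mI => //; apply: measurable_lt_fun => //; exact: marrival.
apply: mI; last by apply: IH; exact: marrival.
by apply: measurable_lt_fun => //; exact: marrival.
Qed.

Lemma arrival_gtE a x : (a < n)%N ->
  [set om | x < arrival om a] = T a @^-1` [set` `]x * w a, +oo[].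
Proof.
move=> an; apply/seteqP; split=> om /=; rewrite in_itv /= andbT /arrival ltr_pdivlMr//;
  exact: lt_le_trans (w1 an).
Qed.

(* The events [B i] on the other variables are carried along so that, in the
   induction step, [x < X a <= x + h] can be absorbed into [box n T B]: the
   induction hypothesis then pinches the increments of the probability in [x]. *)
Lemma chain_prob l rest : uniq (l ++ rest) -> (forall i, i \in l ++ rest -> (i < n)%N) ->
  forall x B, 0 <= x -> (forall i, measurable (B i)) ->
  (forall i, i \in l ++ rest -> B i = setT) ->
  let W := \sum_(i <- l ++ rest) w i in
  Pr ([set om | chain (arrival om) x l rest] `&` box n T B) =
  Pr (box n T B) * (expR (- (W * x)) * seq_prob w W l).
Proof.
elim: l => [|a l IHl] /=.
  elim: rest => [|b rest IH] /=.
    move=> _ _ x B x0 mB _; rewrite big_nil mul0r oppr0 expR0 !mulr1.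
    by rewrite (_ : [set _ | _] = setT) ?setTI//; apply/seteqP.
  move=> /andP[bR U] Rn x B x0 mB BT.
  have bn : (b < n)%N by apply: Rn; rewrite mem_head.
  have w0 := lt_le_trans ltr01 (w1 bn).
  have mI : measurable [set` `]x * w b, +oo[%R] by [].
  (* With [l] empty, the constraints [x < X b] move into the box one item at a time. *)
  have -> : [set om | (x < arrival om b) && all (fun i => x < arrival om i) rest] `&` box n T B =
      [set om | all (fun i => x < arrival om i) rest] `&` box n T (upd B b [set` `]x * w b, +oo[]).
    rewrite box_upd ?BT ?mem_head// -arrival_gtE//.
    apply/seteqP; split=> om /=; first by move=> [/andP[xb c] hB].
    by move=> [c [hB xb]]; split=> //; rewrite xb.
  rewrite IH//; last 3 first.
  - by move=> i iR; apply: Rn; rewrite inE iR orbT.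
  - exact: upd_measurable.
  - move=> i iR; rewrite /upd; case: eqP => [ib|_]; first by rewrite -ib iR in bR.
    by rewrite BT// inE iR orbT.
  rewrite (Pr_box_upd indep) ?BT ?mem_head// Pr_exp_gt; last 2 first.
  - exact: expT.
  - by rewrite mulr_ge0// ltW.
  rewrite big_cons !mulr1 -mulrA -expRD; congr (_ * expR _); ring.
move=> /andP[aLR U] Ln x B x0 mB BT.
have an : (a < n)%N by apply: Ln; rewrite mem_head.
have Ln' i : i \in l ++ rest -> (i < n)%N by move=> iL; apply: Ln; rewrite inE iL orbT.
have /= IH := IHl U Ln'; clear IHl.
set W := \sum_(i <- l ++ rest) w i in IH.
have wa := lt_le_trans ltr01 (w1 an).
have W0 : 0 <= W.
  rewrite /W big_seq sumr_ge0// => i /Ln' i_n; exact: le_trans (w1 i_n).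
have BT' i : i \in l ++ rest -> B i = setT by move=> iL; rewrite BT// inE iL orbT.
have mb := mbox (P := P) n T mB.
have updT I i : i \in l ++ rest -> upd B a I i = setT.
  move=> iL; rewrite /upd; case: eqP => [ia|_]; first by rewrite -ia iL in aLR.
  exact: BT'.
(* The part of the induction hypothesis that does not depend on the starting time. At time 0 the
   hypothesis shows it to be a probability, hence nonnegative. *)
pose c := Pr (box n T B) * seq_prob w W l.
have c0 : 0 <= c.
  have := IH 0 B (lexx _) mB BT'; rewrite -/W mulr0 oppr0 expR0 mul1r -/c => <-.
  exact: Pr_ge0.
pose F y := Pr ([set om | (y < arrival om a) && chain (arrival om) (arrival om a) l rest] `&` box n T B).
have mF y : measurable ([set om | (y < arrival om a) && chain (arrival om) (arrival om a) l rest] `&` box n T B).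
  apply: measurableI => //.
  by have /= := @measurable_chain (fun=> y) (a :: l) rest (measurable_cst _).
have -> : \sum_(i <- a :: l ++ rest) w i = w a + W by rewrite big_cons.
rewrite [X in w a / _ * X](_ : _ = seq_prob w W l); last by rewrite addrAC subrr add0r.
rewrite -/(F x).
have -> : Pr (box n T B) * (expR (- ((w a + W) * x)) * (w a / (w a + W) * seq_prob w W l)) =
  c * (w a / (w a + W)) * expR (- ((w a + W) * x)) by rewrite /c; ring.
apply: (exp_increments (F := F)) => // [y h y0 h0|y y0]; last first.
  rewrite Pr_ge0 /= [w a * y]mulrC -(Pr_exp_gt (expT an)) ?mulr_ge0 ?(ltW wa)//.
  apply: Pr_le; [exact: mF|exact: measurable_preim|].
  by rewrite -arrival_gtE// => om [/= /andP[]].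
have mgt z : measurable [set om | z < arrival om a].
  by apply: measurable_lt_fun; [exact: measurable_cst|exact: marrival].
have yh0 : 0 <= y + h by rewrite addr_ge0// ltW.
pose I := [set` `]y * w a, (y + h) * w a]] : set R.
have PI : Pr (box n T (upd B a I)) =
    Pr (box n T B) * (expR (- (w a * y)) - expR (- (w a * (y + h)))).
  rewrite /I (Pr_box_upd indep) ?BT ?mem_head// (Pr_exp_oc (expT an)).
  - by rewrite [y * _]mulrC [(y + h) * _]mulrC.
  - by rewrite mulr_ge0// ltW.
  - by rewrite ler_wpM2r ?(ltW wa)// lerDl ltW.
have mU := upd_measurable a mB (measurable_itv _ : measurable I).
have boxI : box n T (upd B a I) = box n T B `&` ([set om | y < arrival om a] `&` ~` [set om | y + h < arrival om a]).
  rewrite box_upd ?BT ?mem_head//; congr (_ `&` _); rewrite !arrival_gtE//.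
  apply/seteqP; split=> om; rewrite /I /= !in_itv /= !andbT.
    by move=> /andP[h1 h2]; split=> //; apply/negP; rewrite -leNgt.
  by move=> [h1 /negP]; rewrite -leNgt h1.
have -> : F y - F (y + h) = Pr ([set om | (y < arrival om a) && chain (arrival om) (arrival om a) l rest]
     `&` box n T B `&` ~` [set om | y + h < arrival om a]).
  rewrite {1}/F (Pr_split P (mF y) (mgt (y + h))) (_ : _ `&` [set om | y + h < _] =
    [set om | (y + h < arrival om a) && chain (arrival om) (arrival om a) l rest] `&` box n T B).
    by rewrite -/(F (y + h)) addrAC subrr add0r.
  apply/seteqP; split=> om /=.
    by move=> [[/andP[_ ->] ?] ->].
  by move=> [/andP[hh ->] ?]; rewrite hh (lt_trans _ hh) ?ltrDl.
have mch z : measurable [set om | chain (arrival om) z l rest].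
  exact: (@measurable_chain (fun=> z) l rest (measurable_cst _)).
have mmid : measurable ([set om | (y < arrival om a) && chain (arrival om) (arrival om a) l rest]
     `&` box n T B `&` ~` [set om | y + h < arrival om a]).
  by apply: measurableI; [exact: mF|exact: measurableC].
have lo := IH _ _ yh0 mU (updT I).
have up := IH _ _ y0 mU (updT I).
rewrite PI in lo up.
(* On [y < X a <= y + h], the chain started at [X a] is implied by the chain started at [y + h] and
   implies the one started at [y]; the induction hypothesis evaluates both. *)
apply/andP; split.
  rewrite [leLHS](_ : _ = Pr ([set om | chain (arrival om) (y + h) l rest] `&` box n T (upd B a I))).
    apply: Pr_le => //; first by apply: measurableI => //; exact: mbox.
    rewrite boxI => om /= [ch [hb [ya yha]]]; split=> //; split=> //.
    by rewrite ya; apply: chain_le ch; move/negP: yha; rewrite -leNgt.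
  by rewrite lo /c; ring.
rewrite [leRHS](_ : _ = Pr ([set om | chain (arrival om) y l rest] `&` box n T (upd B a I))).
  apply: Pr_le => //; first by apply: measurableI => //; exact: mbox.
  rewrite boxI => om /= [[/andP[ya ch] hb] yha]; split=> //.
  by apply: chain_le ch; exact: ltW.
by rewrite up /c; ring.
Qed.

Lemma Pr_chain l rest : uniq (l ++ rest) -> (forall i, i \in l ++ rest -> (i < n)%N) ->
  Pr [set om | chain (arrival om) 0 l rest] = seq_prob w (\sum_(i <- l ++ rest) w i) l.
Proof.
move=> U Ln; have /= := chain_prob U Ln (lexx 0) (B := fun=> setT).
rewrite (_ : box _ _ _ = setT) ?setIT ?PrT; last by apply/seteqP.
by rewrite mulr0 oppr0 expR0 !mul1r; apply.
Qed.

End ChainProbability.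

Section Keys.
Context {R : realType} {d : measure_display} {Omega : measurableType d}.
Variables (P : probability Omega R) (T : nat -> {RV P >-> R}) (w : nat -> R).

Lemma measurable_inv : measurable_fun [set: R] (fun x : R => x^-1).
Proof.
(* Squaring makes the base of the real power nonnegative; the outer factor restores the sign and the
   value 0 at 0. *)
rewrite (_ : (fun x => _) = (fun x : R => x * (x ^+ 2) `^ (-1))); last first.
  apply/funext => x; rewrite powR_inv1 ?sqr_ge0//.
  have [->|x0] := eqVneq x 0; first by rewrite invr0 mul0r.
  by rewrite expr2 invfM mulVKf.
apply: measurable_funM => //.
apply: (measurableT_comp (measurable_powR (-1))).
exact: exprn_measurable.
Qed.

Lemma measurable_keyof i : measurable_fun setT (fun om => keyof w T om i).
Proof.
rewrite /keyof; apply: measurable_funM; first exact: measurable_cst.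
exact: measurableT_comp measurable_inv _.
Qed.

End Keys.

(** * From arrival orders to the law of the query *)

Section Correctness.
Context {R : realType} {d : measure_display} {Omega : measurableType d}.
Variables (P : probability Omega R) (n : nat) (T : nat -> {RV P >-> R}) (w : nat -> R).
Hypothesis indep : mutually_independent n T.
Hypothesis expT : forall i, (i < n)%N -> exp1_distributed (T i).
Hypothesis w1 : forall i, (i < n)%N -> 1 <= w i.
Local Notation Pr := (Pr P).
Local Notation X := (arrival T w).

Lemma Pr_all1 (I : eqType) (E : I -> Omega -> bool) (l : seq I) :
  (forall i, measurable [set om | E i om]) ->
  (forall i, i \in l -> Pr [set om | E i om] = 1) ->
  measurable [set om | all (E^~ om) l] /\ Pr [set om | all (E^~ om) l] = 1.
Proof.
move=> mE; elim: l => [|a l IH] /= H.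
  by rewrite (_ : [set _ | _] = setT) ?PrT//; apply/seteqP.
have [m1 p1] : measurable [set om | all (E^~ om) l] /\ Pr [set om | all (E^~ om) l] = 1.
  by apply: IH => i il; apply: H; rewrite inE il orbT.
rewrite (_ : [set _ | _] = [set om | E a om] `&` [set om | all (E^~ om) l]); last first.
  by apply/seteqP; split=> om /=; [move/andP|move=> h; apply/andP].
by split; [exact: measurableI|rewrite PrIfull// H// mem_head].
Qed.

Lemma marr_lt (x : R) i : measurable [set om | x < X om i].
Proof. by apply: measurable_lt_fun; [exact: measurable_cst|exact: marrival]. Qed.

Lemma marr_ne i j : measurable [set om | X om i != X om j].
Proof.
rewrite (_ : [set _ | _] = [set om | X om i < X om j] `|` [set om | X om j < X om i]).
  by apply: measurableU; apply: measurable_lt_fun; exact: marrival.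
by apply/seteqP; split=> om /=; [rewrite neq_lt => /orP|rewrite neq_lt => h; apply/orP].
Qed.

Lemma Pr_arrival_gt0 i : (i < n)%N -> Pr [set om | 0 < X om i] = 1.
Proof.
move=> i_n; rewrite (arrival_gtE T w1 0 i_n) mul0r Pr_exp_gt ?oppr0 ?expR0//.
exact: expT.
Qed.

(** The two strict orders have probabilities [w i / (w i + w j)] and [w j / (w j + w i)], which
    leave nothing for a tie. *)
Lemma Pr_arrival_neq i j : (i < n)%N -> (j < n)%N -> i != j -> Pr [set om | X om i != X om j] = 1.
Proof.
move=> i_n j_n ij.
have wi := lt_le_trans ltr01 (w1 i_n); have wj := lt_le_trans ltr01 (w1 j_n).
have E a b : (a < n)%N -> (b < n)%N -> a != b ->
    Pr [set om | chain (X om) 0 [:: a] [:: b]] = w a / (w a + w b).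
  move=> an bn ab; rewrite (Pr_chain indep expT w1) /=.
  - by rewrite !big_cons big_nil addr0 mulr1.
  - by rewrite inE ab.
  - by move=> z; rewrite !inE => /orP[] /eqP ->.
have mC l r : measurable [set om | chain (X om) 0 l r].
  exact: (@measurable_chain _ _ _ _ _ _ (fun=> 0) l r (measurable_cst _)).
apply/le_anti; rewrite Pr_le1 /=; last exact: marr_ne.
have <- : Pr ([set om | chain (X om) 0 [:: i] [:: j]] `|` [set om | chain (X om) 0 [:: j] [:: i]]) = 1.
  rewrite PrU//; last first.
    apply/seteqP; split=> // om [/= /and3P[_ a _] /and3P[_ b _]].
    by have := lt_trans a b; rewrite ltxx.
  by rewrite !E// 1?eq_sym//; field; rewrite gt_eqF// addr_gt0.
apply: Pr_le; [exact: measurableU|exact: marr_ne|].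
by move=> om [] /= /and3P[_ h _]; rewrite neq_lt h ?orbT.
Qed.

Variables (k s : nat) (site : nat -> 'I_k).
Hypothesis s0 : (0 < s)%N.
Variables (t : nat) (A : {set 'I_n}).
Hypotheses (tn : (t <= n)%N) (At : forall i : 'I_n, i \in A -> (i < t)%N) (cA : #|A| = minn t s).

Local Notation lA := [seq nat_of_ord i | i <- enum A].
Local Notation rest := [seq i <- iota 0 t | i \notin lA].

Lemma mem_lA (i : 'I_n) : (nat_of_ord i \in lA) = (i \in A).
Proof. by rewrite mem_map ?mem_enum//; exact: val_inj. Qed.

Lemma lA_lt i : i \in lA -> (i < t)%N.
Proof. by move=> /mapP[j]; rewrite mem_enum => /At + ->. Qed.

Lemma lA_uniq : uniq lA.
Proof. by rewrite map_inj_uniq ?enum_uniq//; exact: val_inj. Qed.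

Lemma lA_size : size lA = minn t s.
Proof. by rewrite size_map -cardE. Qed.

Lemma perm_lA_rest l : perm_eq l lA -> perm_eq (l ++ rest) (iota 0 t).
Proof.
move=> p; rewrite (permPl (perm_cat p (perm_refl _))).
apply: uniq_perm; [|exact: iota_uniq|].
  rewrite cat_uniq lA_uniq filter_uniq ?iota_uniq// andbT.
  by apply/hasPn => x; rewrite mem_filter => /andP[].
move=> x; rewrite mem_cat mem_filter mem_iota /=.
by have [xA|//] := boolP (x \in lA); rewrite lA_lt.
Qed.

(** Keys are inverse arrival times, so the query sorted by decreasing key lists its items by
    increasing arrival and is itself the witnessing permutation. *)
Lemma query_chain om : (forall i, (i < t)%N -> 0 < X om i) ->
  (forall i j, (i < t)%N -> (j < t)%N -> i != j -> X om i != X om j) ->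
  finset (fun i : 'I_n => nat_of_ord i \in query k s w site (keyof w T om) t) = A <->
  has (fun l => chain (X om) 0 l rest) (permutations lA).
Proof.
move=> X0 Xne.
have kE i : keyof w T om i = (X om i)^-1 by rewrite /keyof /arrival invf_div.
have k0 i : (i < t)%N -> 0 < keyof w T om i by move=> it; rewrite kE invr_gt0 X0.
have kne i j : (i < t)%N -> (j < t)%N -> i != j -> keyof w T om i != keyof w T om j.
  by move=> it jt ij; rewrite !kE (inj_eq invr_inj) Xne.
have klt i j : (i < t)%N -> (j < t)%N -> (keyof w T om i < keyof w T om j) = (X om j < X om i).
  by move=> it jt; rewrite !kE ltf_pV2// posrE X0.
have [] := queryP w site s0 k0 kne; set Q := query _ _ _ _ _ _ => UQ sQ Qt Qs Qtop.
split=> [QA|/hasP[l]].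
  have pQ : perm_eq Q lA.
    apply: uniq_perm; [exact: UQ|exact: lA_uniq|move=> x].
    have [xn|nx] := ltnP x n.
      have -> : x = nat_of_ord (Ordinal xn) by [].
      by rewrite mem_lA -QA inE.
    apply/idP/idP => [/Qt|/lA_lt] xt; by have := leq_trans (leq_trans xt tn) nx; rewrite ltnn.
  apply/hasP; exists Q; first by rewrite mem_permutations.
  have Xinj : {in Q &, injective (X om)}.
    move=> a b aQ bQ ab; apply/eqP/negPn/negP => ne.
    by have := Xne _ _ (Qt _ aQ) (Qt _ bQ) ne; rewrite ab eqxx.
  apply: chainI.
  - have : sorted <%O (map (X om) Q).
      rewrite lt_sorted_uniq_le map_inj_in_uniq// UQ /= sorted_map.
      apply: (sub_in_sorted (P := [in Q]) _ _ Qs); last exact: allss.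
      by move=> a b aQ bQ /=; rewrite !kE lef_pV2// posrE X0// Qt.
    by rewrite sorted_map.
  - by move=> i; rewrite (perm_mem (perm_lA_rest pQ)) mem_iota /= => it; apply: X0.
  - move=> q i qQ; rewrite mem_filter mem_iota /= => /andP[iA it].
    by rewrite -(klt i q it (Qt _ qQ)); apply: Qtop => //; rewrite (perm_mem pQ).
rewrite mem_permutations => pl c.
(* Since [Q] and [lA] have equal sizes, an item [q] of [Q] outside [A] leaves some [a] of [A]
   outside [Q]; then [q] has the larger key, although the chain puts [a] first. *)
have sub : {subset Q <= lA}.
  move=> q qQ; apply/negPn/negP => qA.
  have [AQ|] := boolP (all (mem Q) lA).
    have [|E _] := uniq_min_size lA_uniq (allP AQ); first by rewrite sQ lA_size.
    by have [] := uniq_min_size lA_uniq (allP AQ); rewrite ?sQ ?lA_size// => _ /(_ q); rewrite qQ (negbTE qA).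
  move=> /allPn[a aA aQ].
  have := Qtop q a qQ (lA_lt aA) aQ.
  rewrite (klt a q (lA_lt aA) (Qt _ qQ)) ltNge; apply/negP/negPn/ltW.
  apply: chain_lt c _ _; first by rewrite (perm_mem pl).
  by rewrite mem_filter qA mem_iota /= Qt.
have [|_ QA] := uniq_min_size UQ sub; first by rewrite sQ lA_size.
by apply/setP => i; rewrite inE QA mem_lA.
Qed.

Lemma query_swor :
  P [set om | finset (fun i : 'I_n => nat_of_ord i \in query k s w site (keyof w T om) t) = A]
  = (swor_prob w t lA)%:E.
Proof.
have mS : measurable [set om | finset (fun i : 'I_n => nat_of_ord i \in query k s w site (keyof w T om) t) = A].
  apply: (cmeas_preimage (fun q => finset (fun i : 'I_n => nat_of_ord i \in q) = A)).
  by apply: cmeas_query => i; exact: measurable_keyof.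
have mC l r : measurable [set om | chain (X om) 0 l r].
  exact: (@measurable_chain _ _ _ _ _ _ (fun=> 0) l r (measurable_cst _)).
have [m1 p1] : measurable [set om | all (fun i => 0 < X om i) (iota 0 t)] /\
    Pr [set om | all (fun i => 0 < X om i) (iota 0 t)] = 1.
  apply: (Pr_all1 (E := fun i om => 0 < X om i)) => [i|i]; first exact: marr_lt.
  by rewrite mem_iota /= => it; apply: Pr_arrival_gt0; exact: leq_trans it tn.
pose pairs := [seq p <- allpairs pair (iota 0 t) (iota 0 t) | p.1 != p.2].
have [m2 p2] : measurable [set om | all (fun p => X om p.1 != X om p.2) pairs] /\
    Pr [set om | all (fun p => X om p.1 != X om p.2) pairs] = 1.
  apply: (Pr_all1 (E := fun p om => X om p.1 != X om p.2)) => [p|p]; first exact: marr_ne.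
  rewrite mem_filter => /andP[ne /allpairsP[[a b] /= [a_t b_t pE]]].
  move: ne a_t b_t; rewrite pE !mem_iota /= => ne a_t b_t.
  by apply: Pr_arrival_neq => //; [exact: leq_trans a_t tn|exact: leq_trans b_t tn].
set G1 := [set om | _] in m1 p1; set G2 := [set om | _] in m2 p2.
have mG : measurable (G1 `&` G2) by exact: measurableI.
have pG : Pr (G1 `&` G2) = 1 by rewrite PrIfull.
have mH : measurable [set om | has (fun l => chain (X om) 0 l rest) (permutations lA)].
  elim: (permutations lA) => [|l L IH] /=.
    by rewrite (_ : [set _ | _] = set0)//; apply/seteqP; split=> om.
  rewrite (_ : [set _ | _] = [set om | chain (X om) 0 l rest] `|`
     [set om | has (fun l => chain (X om) 0 l rest) L]); first exact: measurableU.
  by apply/seteqP; split=> om /=; [move/orP|move=> h; apply/orP].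
rewrite PrE//; congr EFin; rewrite -(PrIfull mS mG pG).
(* On the full event of positive, distinct arrivals the query event is a union of chains over the
   orders of [A]. These are disjoint, so their probabilities add up to [swor_prob]. *)
rewrite [X in Pr X](_ : _ = [set om | has (fun l => chain (X om) 0 l rest) (permutations lA)] `&` (G1 `&` G2)).
  rewrite PrIfull// (@Pr_has _ _ _ P _ (fun l om => chain (X om) 0 l rest)) ?permutations_uniq//; last first.
    move=> l1 l2 om; rewrite !mem_permutations => a1 a2; apply: chain_uniq_order.
    by rewrite (permPl a1) perm_sym.
  rewrite /swor_prob big_seq [RHS]big_seq; apply: eq_bigr => l; rewrite mem_permutations => pl.
  have pr := perm_lA_rest pl.
  rewrite (Pr_chain indep expT w1).
  - by rewrite (perm_big _ pr) /= (_ : iota 0 t = index_iota 0 t) ?big_mkord// /index_iota subn0.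
  - by rewrite (perm_uniq pr) iota_uniq.
  - move=> i; rewrite (perm_mem pr) mem_iota /= => it; exact: leq_trans it tn.
have GP om : (G1 `&` G2) om -> (forall i, (i < t)%N -> 0 < X om i) /\
  (forall i j, (i < t)%N -> (j < t)%N -> i != j -> X om i != X om j).
  move=> [/allP g1 /allP g2]; split=> [i it|i j it jt ij].
    by apply: g1; rewrite mem_iota.
  apply: (g2 (i, j)); rewrite mem_filter ij; apply/allpairsP; exists (i, j).
  by rewrite !mem_iota it jt.
apply/seteqP; split=> om [/= h g]; split=> //; have [g1 g2] := GP om g.
  exact/query_chain.
exact: (query_chain g1 g2).2.
Qed.

End Correctness.

(** * Message count *)

Section MessageCount.
Variables (R : realType) (k s : nat) (w : nat -> R) (site : nat -> 'I_k).
Hypothesis s0 : (0 < s)%N.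
Local Notation r := (@rpar R k s).
Local Notation run := (run k s w site).
Local Notation reg := (regular s w site (fun=> 0)).

Definition hits (key : nat -> R) (y : R) (m : nat) : nat :=
  \sum_(0 <= i < m) (reg i && (y <= key i)%R).

(* Bounds the messages charged to the epoch in which [r ^ j <= u < r ^ j.+1]: [u]
   stays below [y] only while fewer than [s] regular items had a key [>= y]. *)
Definition epoch_msgs (n j : nat) (key : nat -> R) : nat :=
  k * (s <= \sum_(0 <= i < n) (r ^+ j <= key i)%R) +
  \sum_(0 <= i < n) ((reg i && (hits key (r ^+ j.+1) i < s)) && (r ^+ j <= key i)%R).

(** Every announced index [j] is witnessed by [s] keys at least [r ^+ j], and a regular message is
    charged to the epoch of the threshold it passed. The middle sum covers the time when [u < 1] and
    no threshold filters. *)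
Lemma msgs_le_epochs key n : exists J,
  (msgs (run key n) <= 2 * \sum_(0 <= i < n) ~~ reg i +
    \sum_(0 <= i < n) (reg i && (hits key 1%R i < s)) +
    \sum_(0 <= j < J) epoch_msgs n j key)%N.
Proof.
have [_ M] := run_tracked w site s0 key n.
have E i : regular s w site key i = reg i by exact: regular_key_irrelevant.
have HE y i : regcount s w site key y i = hits key y i.
  by rewrite /regcount /hits; apply: eq_bigr => a _; rewrite E.
pose nb i := nbcast (clast (run key i)).
(* The maximum over all prefixes puts every epoch index met in the run below [J]. *)
exists (\max_(i < n.+1) nb i)%N; set J := (\max_(_ < _) _)%N.
have nbJ i : (i <= n)%N -> (nb i <= J)%N.
  by rewrite -ltnS => i_n; exact: (leq_bigmax (Ordinal i_n)).
apply: leq_trans (leq_trans (leq_addr _ _) M) _.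
have -> : (\sum_(0 <= i < n) ~~ regular s w site key i = \sum_(0 <= i < n) ~~ reg i)%N.
  by apply: eq_bigr => i _; rewrite E.
have -> : (\sum_(0 <= j < J) epoch_msgs n j key =
    \sum_(0 <= j < J) k * (s <= \sum_(0 <= i < n) (r ^+ j <= key i)%R) +
    \sum_(0 <= j < J) \sum_(0 <= i < n)
      ((reg i && (hits key (r ^+ j.+1) i < s)) && (r ^+ j <= key i)%R))%N.
  by rewrite -big_split.
move: (2 * _)%N => early; rewrite -!addnA leq_add2l addnCA [leqLHS]addnC.
apply: leq_add.
  have [[T1 _ _] _] := run_tracked w site s0 key n.
  have := nbJ n (leqnn n); rewrite /nb => nJ.
  apply: (@leq_trans (\sum_(0 <= j < nbcast (clast (run key n))) k)).
    by rewrite sum_nat_const_nat subn0 mulnC.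
  rewrite [leqRHS](big_cat_nat (leq0n _) nJ)//=; apply: leq_trans (leq_addr _ _).
  rewrite !big_nat; apply: leq_sum => j /andP[_ jn].
  rewrite -[leqLHS]muln1 leq_mul2l; apply/orP; right.
  rewrite lt0b; apply: (@count_key_ge _ _ _ w site s0); first exact: rparX_gt0.
  move: jn; rewrite T1; have := jofP k s key (cS (run key n)).
  case: jof => //= a /andP[h _]; rewrite ltnS => ja; apply: le_trans h.
  by rewrite ler_weXn2l// ltW// rpar_gt1.
rewrite exchange_big_nat -big_split /= !big_nat; apply: leq_sum => i /andP[_ i_n].
rewrite E; have [ri|//] := boolP (reg i); rewrite /sent /=.
have [[T1 T2 _] _] := run_tracked w site s0 key i.
case: ltP => //= h; rewrite T2 T1 in h.
have := jofP k s key (cS (run key i)); have := nbJ i (ltnW i_n); rewrite /nb T1.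
case: jof h => [j|] /= h; last first.
  move=> _ /(@regcount_lt _ _ _ w site s0 key 1 i (lexx _)).
  by rewrite HE => ->.
move=> jJ /andP[_ u]; have := @regcount_lt _ _ _ w site s0 key _ i (rparX_ge1 R k s j.+1) u.
rewrite HE => hj; apply: leq_trans (leq_addl _ _).
rewrite big_mkord (bigD1 (Ordinal jJ))//= hj /=.
by rewrite (ltW h).
Qed.

(** Each counted item raises [hits] by one while it is still below [s], so counting stops after [s]
    items. This holds for every outcome. *)
Lemma hits_sum_le key y n :
  (\sum_(0 <= i < n) ((reg i && (hits key y i < s)) && (y <= key i)%R) <= s)%N.
Proof.
suff : (\sum_(0 <= i < n) ((reg i && (hits key y i < s)) && (y <= key i)%R) <=
    minn s (hits key y n))%N by move=> /leq_trans; apply; exact: geq_minl.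
elim: n => [|n IH]; first by rewrite big_geq.
have -> : hits key y n.+1 = (hits key y n + (reg n && (y <= key n)%R))%N.
  by rewrite /hits big_nat_recr.
rewrite big_nat_recr//=; move: (\sum_(_ <= _ < _) _)%N (hits key y n) IH => a b IH.
by case: (reg n) => //=; case: (y <= key n) => /=; case: ltnP => //=; lia.
Qed.

End MessageCount.

(** * Expectations of natural-valued functions *)

Section NatExpectation.
Context {R : realType} {d : measure_display} {Omega : measurableType d}.
Variable P : probability Omega R.

Definition Ex (f : Omega -> nat) : \bar R := (\int[P]_om ((f om)%:R)%:E)%E.

Lemma cmeas_EFin (f : Omega -> nat) : cmeas f ->
  measurable_fun setT (fun om => ((f om)%:R)%:E : \bar R).
Proof.
move=> mf _ Y mY; rewrite setTI.
exact: (cmeas_preimage (fun m : nat => Y (m%:R)%:E) mf).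
Qed.

Lemma Ex_ge0 f : (0 <= Ex f)%E.
Proof. by apply: integral_ge0 => om _; rewrite lee_fin. Qed.

Lemma Ex_le f g : cmeas f -> cmeas g -> (forall om, (f om <= g om)%N) -> (Ex f <= Ex g)%E.
Proof.
move=> mf mg fg; apply: ge0_le_integral => //; try exact: cmeas_EFin.
by move=> om _; rewrite lee_fin ler_nat.
Qed.

Lemma Ex_cst c : Ex (fun=> c) = (c%:R)%:E.
Proof.
rewrite /Ex -[RHS]mule1 -(probability_setT P).
exact: (integral_cst P measurableT).
Qed.

Lemma cmeas_bin (op : nat -> nat -> nat) (f g : Omega -> nat) : cmeas f -> cmeas g ->
  cmeas (fun om => op (f om) (g om)).
Proof.
move=> mf mg; apply: (cmeas_bind (F := fun a om => op a (g om)) mf) => a.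
exact: cmeas_comp.
Qed.

Lemma cmeas_sum m (F : nat -> Omega -> nat) : (forall i, cmeas (F i)) ->
  cmeas (fun om => \sum_(0 <= i < m) F i om)%N.
Proof.
move=> mF; elim: m => [|m IH].
  by apply: cmeas_ext (cmeas_cst 0%N) => om; rewrite big_geq.
apply: cmeas_ext (cmeas_bin addn IH (mF m)) => om; by rewrite big_nat_recr.
Qed.

Lemma Ex_add f g : cmeas f -> cmeas g -> Ex (fun om => f om + g om)%N = (Ex f + Ex g)%E.
Proof.
move=> mf mg; rewrite /Ex -ge0_integralD//; try exact: cmeas_EFin.
by apply: eq_integral => om _; rewrite natrD EFinD.
Qed.

Lemma Ex_mul c f : cmeas f -> Ex (fun om => c * f om)%N = ((c%:R)%:E * Ex f)%E.
Proof.
move=> mf; rewrite /Ex -ge0_integralZl_EFin//; last exact: cmeas_EFin.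
by apply: eq_integral => om _; rewrite natrM EFinM.
Qed.

Lemma cmeas_nat_of_bool (b : Omega -> bool) : measurable [set om | b om] ->
  cmeas (fun om => nat_of_bool (b om)).
Proof. by move=> mb; exact: cmeas_comp nat_of_bool (cmeas_bool mb). Qed.

Lemma Ex_bool (b : Omega -> bool) : measurable [set om | b om] ->
  Ex (fun om => nat_of_bool (b om)) = (Pr P [set om | b om])%:E.
Proof.
move=> mb; rewrite -PrE// -[in RHS](setIT [set om | b om]) -integral_indic//.
apply: eq_integral => om _; rewrite indicE.
by case E: (b om); [rewrite mem_set|rewrite memNset//= E].
Qed.

Lemma Ex_sum_bool m (b : nat -> Omega -> bool) : (forall i, measurable [set om | b i om]) ->
  Ex (fun om => \sum_(0 <= i < m) b i om)%N = (\sum_(i < m) Pr P [set om | b i om])%:E.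
Proof.
move=> mb; elim: m => [|m IH].
  rewrite big_ord0 -[in RHS](mulr0n 1) -Ex_cst; congr Ex; apply/funext => om.
  by rewrite big_geq.
rewrite big_ord_recr /= EFinD -IH -Ex_bool// -Ex_add.
- by congr Ex; apply/funext => om; rewrite big_nat_recr.
- by apply: cmeas_sum => i; exact: cmeas_nat_of_bool.
- exact: cmeas_nat_of_bool.
Qed.

(** As [J] varies with the outcome, the partial sum is replaced by the full series, which
    nonnegativity allows to be exchanged with the integral. *)
Lemma Ex_series f g (G : nat -> Omega -> nat) : cmeas f -> cmeas g -> (forall j, cmeas (G j)) ->
  (forall om, exists J, (f om <= g om + \sum_(0 <= j < J) G j om)%N) ->
  (Ex f <= Ex g + \sum_(j <oo) Ex (G j))%E.
Proof.
move=> mf mg mG H.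
have G0 j om : (0 <= ((G j om)%:R)%:E :> \bar R)%E by rewrite lee_fin.
rewrite /Ex -integral_nneseries//; last by move=> j; exact: cmeas_EFin.
have mS : measurable_fun setT (fun om => (\sum_(j <oo) ((G j om)%:R)%:E)%E : \bar R).
  by apply: ge0_emeasurable_sum => // j _; exact: cmeas_EFin.
rewrite -ge0_integralD//.
- apply: ge0_le_integral => //.
  + exact: cmeas_EFin.
  + by apply: emeasurable_funD => //; exact: cmeas_EFin.
  + move=> om _; have [J h] := H om.
    apply: (@le_trans _ _ (((g om)%:R)%:E + \sum_(0 <= j < J) ((G j om)%:R)%:E)%E).
      by rewrite sumEFin -EFinD lee_fin -natr_sum -natrD ler_nat.
    by apply: leeD2l; apply: nneseries_lim_ge.
- exact: cmeas_EFin.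
- by move=> om _; apply: nneseries_ge0.
Qed.

End NatExpectation.

(** * Tails of the keys and the stopping argument *)

Section KeyTails.
Context {R : realType} {d : measure_display} {Omega : measurableType d}.
Variables (P : probability Omega R) (n : nat) (T : nat -> {RV P >-> R}) (w : nat -> R).
Hypothesis indep : mutually_independent n T.
Hypothesis expT : forall i, (i < n)%N -> exp1_distributed (T i).
Hypothesis w1 : forall i, (i < n)%N -> 1 <= w i.
Local Notation Pr := (Pr P).
Local Notation K := (keyof w T).

Definition tail i y : R := Pr [set om | y <= K om i].

Lemma mkey_ge i y : measurable [set om | y <= K om i].
Proof.
apply: (cmeas_preimage is_true); apply: cmeas_le; first exact: measurable_cst.
exact: measurable_keyof.
Qed.

Lemma tailE i y : (i < n)%N -> 0 < y -> tail i y = 1 - expR (- (w i / y)).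
Proof.
move=> i_n y0; have w0 := lt_le_trans ltr01 (w1 i_n).
rewrite -{1}(expR0 R) -oppr0 -(Pr_exp_oc (expT i_n)) ?divr_ge0 ?(ltW w0) ?(ltW y0)//.
congr Pr; apply/seteqP; split=> om /=; rewrite in_itv /= /keyof.
  move=> h; have T0 : 0 < T i om.
    rewrite ltNge; apply/negP => T0; have := lt_le_trans y0 h; apply/negP; rewrite -leNgt.
    by rewrite (pmulr_rle0 _ w0) invr_le0.
  by rewrite T0 /= ler_pdivlMr// mulrC -ler_pdivlMr.
by move=> /andP[T0 h]; rewrite ler_pdivlMr// mulrC -ler_pdivlMr.
Qed.

Lemma tail_le i y : (i < n)%N -> 0 < y -> tail i y <= w i / y.
Proof.
move=> i_n y0; rewrite tailE//; have w0 := lt_le_trans ltr01 (w1 i_n).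
have := expR_ge1Dx (- (w i / y)); lra.
Qed.

Lemma tail_ge0 i y : 0 <= tail i y.
Proof. exact: Pr_ge0. Qed.

Lemma tail_le1 i y : tail i y <= 1.
Proof. by apply: Pr_le1; exact: mkey_ge. Qed.

Lemma tail_lower i y : (i < n)%N -> 0 < y -> w i / y <= (1 + w i / y) * tail i y.
Proof.
move=> i_n y0; rewrite tailE//; have w0 := lt_le_trans ltr01 (w1 i_n).
set x := w i / y; have x0 : 0 <= x by rewrite divr_ge0// ltW.
have E : expR x * expR (- x) = 1 by rewrite expRxMexpNx_1.
have : (1 + x) * expR (- x) <= 1.
  by rewrite -[leRHS]E; apply: ler_wpM2r; [exact: expR_ge0|exact: expR_ge1Dx].
lra.
Qed.

(** With [x = w i / (a * y)], the left tail is at most both 1 and [a * x], while the right tail is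
    at least [x / (1 + x)], hence at least half the minimum of [x] and 1. *)
Lemma tail_scale i y a : (i < n)%N -> 0 < y -> 1 <= a -> tail i y <= 2 * a * tail i (a * y).
Proof.
move=> i_n y0 a1; have a0 := lt_le_trans ltr01 a1.
have w0 := lt_le_trans ltr01 (w1 i_n).
have ay0 : 0 < a * y by rewrite mulr_gt0.
have lo := tail_lower i_n ay0; have up := tail_le i_n y0.
have up1 := tail_le1 i y; have t0 := tail_ge0 i y; have t0' := tail_ge0 i (a * y).
set p := tail i y in up up1 t0 *; set q := tail i (a * y) in lo t0' *.
have E : w i / y = a * (w i / (a * y)) by field; rewrite !gt_eqF.
rewrite E in up; set x := w i / (a * y) in lo up.
have x0 : 0 <= x by rewrite divr_ge0// ltW.
have [x1|x1] := leP x 1.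
  have : x <= 2 * q.
    apply: le_trans lo _; apply: ler_wpM2r => //; lra.
  move=> h; apply: le_trans up _; rewrite [leRHS](_ : _ = a * (2 * q)); last by ring.
  by rewrite ler_wpM2l// ltW.
have q2 : 1 <= 2 * q.
  have : x <= (2 * x) * q by apply: le_trans lo _; apply: ler_wpM2r => //; lra.
  move=> h; rewrite -(ler_pM2l (lt_trans ltr01 x1)) mulr1.
  by rewrite mulrA [x * 2]mulrC.
apply: le_trans up1 _; apply: le_trans q2 _.
by rewrite [leRHS](_ : _ = a * (2 * q)); [rewrite ler_peMl// mulr_ge0|ring].
Qed.

Lemma tail1_ge i : (i < n)%N -> 1 <= 2 * tail i 1.
Proof.
move=> i_n; have := tail_lower i_n ltr01; rewrite divr1; have := w1 i_n; have := tail_ge0 i 1.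
nra.
Qed.

Variables (k s : nat) (site : nat -> 'I_k).
Hypothesis s0 : (0 < s)%N.
Local Notation r := (@rpar R k s).
Local Notation reg := (regular s w site (fun=> 0)).
Local Notation nhits := (hits s w site).

Lemma mkey_cond m y : measurable [set x : R | y <= w m / x].
Proof.
apply: (cmeas_preimage (Omega := R) is_true); apply: cmeas_le; first exact: measurable_cst.
by apply: measurable_funM; [exact: measurable_cst|exact: measurable_inv].
Qed.

(** A decision tree: if the key of item [m] reaches [y] and the item is regular, the remaining
    budget for earlier items falls to [c.-1]; otherwise it stays [c]. *)
Lemma past_hits y m c : (m <= n)%N -> past n T m [set om | (nhits (K om) y m < c)%N].
Proof.
elim: m c => [|m IH] c mn.
  case: c => [|c].
    by rewrite (_ : [set _ | _] = set0); [exact: past_set0|apply/seteqP; split=> om].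
  rewrite (_ : [set _ | _] = setT); first exact: past_setT.
  by apply/seteqP; split=> om //= _; rewrite /hits big_geq.
have HS om : nhits (K om) y m.+1 = (nhits (K om) y m + (reg m && (y <= K om m)%R))%N.
  by rewrite /hits big_nat_recr.
pose c' := if reg m then c.-1 else c.
have := past_branch indep mn (IH c' (ltnW mn)) (IH c (ltnW mn)) (mkey_cond m y).
congr past; apply/seteqP; split=> om /=; rewrite HS.
  rewrite /c' -[w m / T m om]/(K om m); case: (reg m) => /=.
    by move=> [[h ->]|[h /negP/negbTE ->]]; lia.
  by rewrite addn0 => -[] [].
rewrite /c' -[w m / T m om]/(K om m); case: (boolP (y <= K om m)) => yK.
  by rewrite andbT => h; left; split=> //; case: (reg m) h => /=; lia.
by rewrite andbF addn0 => h; right; split=> //; apply/negP.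
Qed.

Definition active i y : R := Pr [set om | reg i && (nhits (K om) y i < s)%N].

Lemma mactive i y : measurable [set om | reg i && (nhits (K om) y i < s)%N].
Proof.
apply: (cmeas_preimage is_true (f := fun om => reg i && (nhits (K om) y i < s)%N)).
apply: (cmeas_comp (fun h => reg i && (h < s)%N)); apply: cmeas_sum => a.
apply: (cmeas_nat_of_bool (b := fun om => reg a && (y <= K om a))).
case: (reg a) => /=; first exact: mkey_ge.
by rewrite (_ : [set _ | _] = set0)//; apply/seteqP; split=> om.
Qed.

Lemma mactive_key i y z :
  measurable [set om | (reg i && (nhits (K om) y i < s)%N) && (z <= K om i)].
Proof.
rewrite (_ : [set _ | _] = [set om | reg i && (nhits (K om) y i < s)%N] `&` [set om | z <= K om i]).
  by apply: measurableI; [exact: mactive|exact: mkey_ge].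
by apply/seteqP; split=> om /=; [move/andP|move=> h; apply/andP].
Qed.

Lemma active_indep i y z : (i < n)%N ->
  Pr [set om | (reg i && (nhits (K om) y i < s)%N) && (z <= K om i)] = active i y * tail i z.
Proof.
move=> i_n; rewrite /active /tail; case: (reg i) => /=; last first.
  rewrite (_ : [set _ : Omega | false] = set0) ?Pr0 ?mul0r//.
  by apply/seteqP; split=> om.
rewrite -[[set om | z <= K om i]]/(T i @^-1` [set x | z <= w i / x]).
rewrite -(past_indep i_n (past_hits y s (ltnW i_n)) (mkey_cond i z)).
by congr Pr; apply/seteqP; split=> om /=; [move/andP|move=> h; apply/andP].
Qed.

(** The expectation of [hits_sum_le]: each term factors because the counter depends only on
    variables before [T i]. *)
Lemma active_tail_sum y : \sum_(i < n) active i y * tail i y <= s%:R.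
Proof.
rewrite -lee_fin.
have -> : (\sum_(i < n) active i y * tail i y) =
   \sum_(i < n) Pr [set om | (reg i && (nhits (K om) y i < s)%N) && (y <= K om i)].
  by apply: eq_bigr => i _; rewrite active_indep.
rewrite -(@Ex_sum_bool _ _ _ P n (fun i om => (reg i && (nhits (K om) y i < s)%N) && (y <= K om i))).
  rewrite -(Ex_cst P); apply: Ex_le.
  - by apply: cmeas_sum => i; apply: cmeas_nat_of_bool; exact: mactive_key.
  - exact: cmeas_cst.
  - by move=> om; exact: hits_sum_le.
by move=> i; exact: mactive_key.
Qed.

Lemma active_sum_le y (f : nat -> R) a : 0 <= a ->
  (forall i, (i < n)%N -> f i <= a * tail i y) ->
  \sum_(i < n) active i y * f i <= a * s%:R.
Proof.
move=> a0 fa; apply: le_trans (ler_wpM2l a0 (active_tail_sum y)).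
rewrite mulr_sumr; apply: ler_sum => i _; rewrite mulrCA.
by apply: ler_wpM2l; [exact: Pr_ge0|exact: fa].
Qed.

(** Markov's inequality for the number of keys at least [y], whose mean is at most the sum of the
    [w i / y]. *)
Lemma many_keys y : 0 < y ->
  s%:R * Pr [set om | (s <= \sum_(0 <= i < n) (y <= K om i)%R)%N] <= (\sum_(i < n) w i) / y.
Proof.
move=> y0.
have mc : cmeas (fun om => \sum_(0 <= i < n) (y <= K om i)%R)%N.
  by apply: cmeas_sum => i; apply: cmeas_nat_of_bool; exact: mkey_ge.
have mF : measurable [set om | (s <= \sum_(0 <= i < n) (y <= K om i)%R)%N].
  exact: (cmeas_preimage (fun h => (s <= h)%N) mc).
apply: (@le_trans _ _ (\sum_(i < n) tail i y)); last first.
  by rewrite mulr_suml; apply: ler_sum => i _; exact: tail_le.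
rewrite -lee_fin EFinM -(Ex_bool _ mF) -Ex_mul; last exact: cmeas_nat_of_bool.
rewrite -(@Ex_sum_bool _ _ _ P n (fun i om => y <= K om i)); last by move=> i; exact: mkey_ge.
apply: Ex_le => //.
  by apply: (cmeas_comp (muln s)); exact: cmeas_nat_of_bool.
move=> om /=; have [h|_] := boolP (s <= \sum_(0 <= i < n) (y <= K om i)%R)%N.
  by rewrite muln1.
by rewrite muln0.
Qed.

End KeyTails.

(** * Geometric sums and logarithm estimates *)

Section GeometricTail.
Variable R : realType.

Lemma sum_geometric_tail (b : nat -> R) (r D c : R) (J N : nat) : 2 <= r -> 0 <= D -> 0 <= c ->
  (forall j, 0 <= b j) -> (forall j, b j <= D) -> (forall j, b j <= c / r ^+ j) ->
  \sum_(j < N) b j <= J%:R * D + 2 * (c / r ^+ J).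
Proof.
move=> r2 D0 c0 b0 bD bc; have r0 : 0 < r by lra.
have X0 j : 0 < r ^+ j by rewrite exprn_gt0.
have pre M : \sum_(j < M) b j <= M%:R * D.
  rewrite -[M in M%:R]card_ord mulr_natl -sumr_const; exact: ler_sum.
(* The subtracted term makes the induction close: with [z = c / r ^+ (J + m)], one step needs
   [z <= 2 * (z - z / r)], which holds as [2 <= r]. *)
have post m : \sum_(j < J + m) b j <= J%:R * D + 2 * (c / r ^+ J - c / r ^+ (J + m)).
  elim: m => [|m IH]; first by rewrite addn0 subrr mulr0 addr0.
  rewrite addnS big_ord_recr /=; apply: le_trans (lerD IH (bc _)) _.
  rewrite -addrA lerD2l exprS; set z := c / r ^+ (J + m).
  have -> : c / (r * r ^+ (J + m)) = z / r by rewrite /z; field; rewrite !gt_eqF.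
  have : 2 * (z / r) <= z.
    have z0 : 0 <= z by rewrite divr_ge0// ltW.
    by rewrite mulrA ler_pdivrMr// mulrC ler_wpM2l.
  lra.
apply: (@le_trans _ _ (\sum_(j < J + N) b j)).
  rewrite addnC big_split_ord /= lerDl sumr_ge0//.
apply: le_trans (post N) _; rewrite lerD2l mulrBr lerBlDr lerDl.
by rewrite mulr_ge0// divr_ge0// ltW.
Qed.

Lemma ln1Dx_le (x : R) : 0 <= x -> ln (1 + x) <= x.
Proof.
by move=> x0; rewrite -[leRHS]expRK ler_ln ?posrE ?expR_gt0 ?expR_ge1Dx//; lra.
Qed.

Lemma ln_ge_half (x : R) : 2 <= x -> 1 / 2 <= ln x.
Proof.
move=> x2; have x0 : 0 < x by lra.
have i0 : 0 < x^-1 by rewrite invr_gt0.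
have i2 : x^-1 <= 1 / 2 by rewrite invf_ple ?posrE//; lra.
have : ln (x^-1) <= x^-1 - 1.
  by rewrite -[leRHS]expRK ler_ln ?posrE ?expR_gt0//; have := expR_ge1Dx (x^-1 - 1); lra.
rewrite lnV ?posrE//; lra.
Qed.

(* Monotonicity of [x / (1 + ln (1 + x))], in cross-multiplied form. *)
Lemma mul_ln_le (x y : R) : 0 <= x -> x <= y -> x * ln (1 + y) <= y * (1 + ln (1 + x)).
Proof.
move=> x0 xy.
have x1 : 0 < 1 + x by lra.
have E : ln (1 + y) = ln (1 + x) + ln (1 + (y - x) / (1 + x)).
  rewrite -lnM ?posrE//; last by rewrite ltr_pwDl// divr_ge0// ?subr_ge0// ltW.
  by congr ln; field; rewrite gt_eqF.
have d0 : 0 <= (y - x) / (1 + x) by rewrite divr_ge0 ?subr_ge0// ltW.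
have l0 : 0 <= ln (1 + x) by rewrite ln_ge0// lerDl.
have h : x * ((y - x) / (1 + x)) <= y - x.
  rewrite mulrA ler_pdivrMr// mulrC ler_wpM2l ?subr_ge0//; lra.
have h1 := ler_wpM2l x0 (ln1Dx_le d0).
have h2 := ler_wpM2r l0 xy.
rewrite E; lra.
Qed.

End GeometricTail.

(** * The expected number of messages *)

Section Messages.
Context {R : realType} {d : measure_display} {Omega : measurableType d}.
Variables (P : probability Omega R) (n : nat) (T : nat -> {RV P >-> R}) (w : nat -> R).
Hypothesis indep : mutually_independent n T.
Hypothesis expT : forall i, (i < n)%N -> exp1_distributed (T i).
Hypothesis w1 : forall i, (i < n)%N -> 1 <= w i.
Local Notation Pr := (Pr P).
Local Notation K := (keyof w T).
Variables (k s : nat) (site : nat -> 'I_k).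
Hypotheses (k0 : (0 < k)%N) (s0 : (0 < s)%N).
Local Notation r := (@rpar R k s).
Local Notation reg := (regular s w site (fun=> 0)).
Local Notation nhits := (hits s w site).
Local Notation W := (\sum_(i < n) w i).
Local Notation act := (active T w s site).

Definition epoch_mean j : R :=
  k%:R * Pr [set om | (s <= \sum_(0 <= i < n) (r ^+ j <= K om i)%R)%N] +
  \sum_(i < n) act i (r ^+ j.+1) * tail T w i (r ^+ j).

Lemma total_weight_ge0 : 0 <= W.
Proof. by rewrite sumr_ge0// => i _; exact: le_trans (w1 (ltn_ord i)). Qed.

Lemma mcount y : cmeas (fun om => \sum_(0 <= i < n) (y <= K om i)%R)%N.
Proof. by apply: cmeas_sum => i; apply: cmeas_nat_of_bool; exact: mkey_ge. Qed.

Lemma mmany y : measurable [set om | (s <= \sum_(0 <= i < n) (y <= K om i)%R)%N].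
Proof. exact: (cmeas_preimage (fun h => (s <= h)%N) (mcount y)). Qed.

Lemma cmeas_epoch j : cmeas (fun om => epoch_msgs s w site n j (K om)).
Proof.
apply: (cmeas_bin addn).
  by apply: (cmeas_comp (muln k)); apply: cmeas_nat_of_bool; exact: mmany.
by apply: cmeas_sum => i; apply: cmeas_nat_of_bool; exact: mactive_key.
Qed.

Lemma Ex_epoch j : Ex P (fun om => epoch_msgs s w site n j (K om)) = (epoch_mean j)%:E.
Proof.
rewrite /epoch_msgs Ex_add; last 2 first.
- by apply: (cmeas_comp (muln k)); apply: cmeas_nat_of_bool; exact: mmany.
- by apply: cmeas_sum => i; apply: cmeas_nat_of_bool; exact: mactive_key.
rewrite Ex_mul; last by apply: cmeas_nat_of_bool; exact: mmany.
rewrite Ex_bool; last exact: mmany.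
rewrite (@Ex_sum_bool _ _ _ P n (fun i om =>
  (reg i && (nhits (K om) (r ^+ j.+1) i < s)%N) && (r ^+ j <= K om i))); last first.
  by move=> i; exact: mactive_key.
rewrite -EFinM -EFinD /epoch_mean; congr (_ + _)%:E.
by apply: eq_bigr => i _; rewrite (active_indep w indep site s0).
Qed.

Lemma epoch_mean_ge0 j : 0 <= epoch_mean j.
Proof.
apply: addr_ge0; first by rewrite mulr_ge0// Pr_ge0.
by apply: sumr_ge0 => i _; rewrite mulr_ge0// Pr_ge0.
Qed.

Lemma epoch_mean_le j : epoch_mean j <= k%:R + 2 * r * s%:R.
Proof.
apply: lerD.
  by rewrite ler_piMr// Pr_le1//; exact: mmany.
apply: (active_sum_le indep site s0 (f := fun i => tail T w i (r ^+ j))) => [|i i_n]; first by rewrite mulr_ge0// ltW// rpar_gt0.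
rewrite exprS; apply: (tail_scale expT w1) => //; first exact: rparX_gt0.
by rewrite ltW// rpar_gt1.
Qed.

(** For high epochs the stopping condition is bounded by 1: Markov handles the broadcast, and the
    union of all tails handles the regular messages. *)
Lemma epoch_mean_late j : epoch_mean j <= (k%:R / s%:R + 1) * W / r ^+ j.
Proof.
have sR : 0 < s%:R :> R by rewrite ltr0n.
rewrite mulrDl mul1r mulrDl; apply: lerD.
  rewrite -!mulrA ler_wpM2l// mulrC ler_pdivlMr// mulrC.
  exact: (many_keys expT w1 s (rparX_gt0 R k s j)).
rewrite mulr_suml; apply: ler_sum => i _.
apply: le_trans (tail_le expT w1 (ltn_ord i) (rparX_gt0 R k s j)).
by rewrite ler_piMl ?Pr_ge0// Pr_le1//; exact: mactive.
Qed.

(** As weights are at least 1, each key reaches 1 with probability at least one half, so [s] such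
    keys are expected within [2 * s] regular items. *)
Lemma active1_le : \sum_(i < n) act i 1 <= 2 * s%:R.
Proof.
under eq_bigr do rewrite -[act _ _]mulr1.
apply: (active_sum_le indep site s0 (f := fun=> 1)) => // i i_n.
exact: (tail1_ge expT w1).
Qed.

Lemma cmeas_msgs : cmeas (fun om => msgs (run k s w site (K om) n)).
Proof.
apply: cmeas_comp; apply: cmeas_run => i; exact: measurable_keyof.
Qed.

Lemma Ex_msgs_le J : (Ex P (fun om => msgs (run k s w site (K om) n)) <=
  (2 * (J%:R * (4 * r * s%:R + 1) + W / r ^+ J) + 2 * s%:R +
   (J%:R * (k%:R + 2 * r * s%:R) + 2 * ((k%:R / s%:R + 1) * W / r ^+ J)))%:E)%E.
Proof.
pose g om := (2 * \sum_(0 <= i < n) ~~ reg i +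
    \sum_(0 <= i < n) (reg i && (nhits (K om) 1%R i < s)))%N.
have mg0 : cmeas (fun om => \sum_(0 <= i < n) (reg i && (nhits (K om) 1%R i < s)))%N.
  by apply: cmeas_sum => i; apply: cmeas_nat_of_bool; exact: mactive.
have mg : cmeas g by exact: cmeas_comp (addn _) mg0.
apply: le_trans (Ex_series P cmeas_msgs mg cmeas_epoch _) _.
  by move=> om; exact: msgs_le_epochs.
rewrite EFinD; apply: leeD.
  rewrite /g Ex_add//; last exact: cmeas_cst.
  rewrite Ex_cst (@Ex_sum_bool _ _ _ P n (fun i om => reg i && (nhits (K om) 1%R i < s)%N)).
    rewrite -EFinD lee_fin natrM; apply: lerD; last exact: active1_le.
    by rewrite ler_wpM2l//; exact: early_le.
  by move=> i; exact: mactive.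
apply: lime_le.
  by apply: is_cvg_nneseries => j _ _; exact: Ex_ge0.
apply: nearW => N; rewrite big_mkord.
under eq_bigr do rewrite Ex_epoch.
rewrite sumEFin lee_fin; apply: sum_geometric_tail.
- exact: rpar_ge2.
- by rewrite addr_ge0// !mulr_ge0// ltW// rpar_gt0.
- by rewrite mulr_ge0 ?total_weight_ge0// addr_ge0// divr_ge0.
- exact: epoch_mean_ge0.
- exact: epoch_mean_le.
- exact: epoch_mean_late.
Qed.

Lemma Ex_msgs_log : (Ex P (fun om => msgs (run k s w site (K om) n)) <=
  (17 * r * s%:R * (1 + ln (1 + W / s%:R) / ln r))%:E)%E.
Proof.
have sR : 1 <= s%:R :> R by rewrite ler1n.
have W0 := total_weight_ge0; have r2 := rpar_ge2 R k s; have lr := ln_rpar_gt0 R k s.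
have krs := leq_rparM R k s0.
set x := W / s%:R; have x0 : 0 <= x by rewrite divr_ge0// ltW// (lt_le_trans ltr01).
set q := ln (1 + x) / ln r.
have q0 : 0 <= q by rewrite divr_ge0 ?(ltW lr)// ln_ge0// lerDl.
(* [J] is the integer part of [log_r (1 + W / s)] plus one, which makes [W / r ^+ J] at most [s]. *)
have [J [J1 Jq xJ]] : exists J : nat,
    [/\ 1 <= J%:R :> R, J%:R <= 1 + q & x <= r ^+ J].
  have x1 : 0 < 1 + x by rewrite ltr_pwDl.
  exists (Num.truncn q).+1; split.
  - by rewrite ler1n.
  - by rewrite -natr1 addrC lerD2l truncn_le.
  - have : ln (1 + x) <= ln (r ^+ (Num.truncn q).+1).
      rewrite lnXn ?rpar_gt0// -mulr_natl -ler_pdivrMr//; apply/ltW; exact: truncnS_gt.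
    rewrite ler_ln ?posrE ?rparX_gt0//; apply: le_trans.
    by rewrite lerDr.
have WJ : W / r ^+ J <= s%:R.
  by rewrite ler_pdivrMr ?rparX_gt0// mulrC -ler_pdivrMr// (lt_le_trans ltr01).
apply: le_trans (Ex_msgs_le J) _; rewrite lee_fin.
have rs : 2 * s%:R <= r * s%:R by rewrite ler_wpM2r.
have last : (k%:R / s%:R + 1) * W / r ^+ J <= k%:R + s%:R.
  rewrite -mulrA [leRHS](_ : _ = (k%:R / s%:R + 1) * s%:R); last by field; lra.
  by rewrite ler_wpM2l// addr_ge0// divr_ge0.
have : 17 * (r * s%:R) * J%:R <= 17 * r * s%:R * (1 + q).
  have z0 : 0 <= 17 * (r * s%:R) by lra.
  by rewrite -[17 * r * _]mulrA; exact: ler_wpM2l.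
(* With [z = r * s], the bound is at most [11 * z * J + 2 * J + 6 * s + 2 * k]; from [2 <= z],
   [2 * s <= z], [k <= z] and [1 <= J] the total is at most [(11 + 1 + 3 + 2) * z * J]. *)
apply: le_trans.
rewrite [4 * r * _](_ : _ = 4 * (r * s%:R)); last by ring.
rewrite [2 * r * _](_ : _ = 2 * (r * s%:R)); last by ring.
move: (r * s%:R) rs krs => z rs krs.
have e1 : z <= z * J%:R by rewrite ler_peMr//; lra.
have e2 : J%:R * k%:R <= J%:R * z by rewrite ler_wpM2l.
have e3 : J%:R <= J%:R * z / 2 by rewrite ler_pdivlMr// ler_wpM2l//; lra.
lra.
Qed.

Lemma expected_msgs_le : (Ex P (fun om => msgs (run k s w site (K om) n)) <=
  (68 * k%:R * (1 + ln (1 + W / s%:R)) / ln (1 + k%:R / s%:R))%:E)%E.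
Proof.
have sR : 0 < s%:R :> R by rewrite ltr0n.
have kR : 0 < k%:R :> R by rewrite ltr0n.
have W0 := total_weight_ge0; have lr := ln_rpar_gt0 R k s.
set x := W / s%:R; set y := k%:R / s%:R.
have x0 : 0 <= x by rewrite divr_ge0// ltW.
have y0 : 0 < y by rewrite divr_gt0.
have ly : 0 < ln (1 + y) by rewrite ln_gt0// ltrDl.
set L := ln (1 + x); have L0 : 0 <= L by rewrite ln_ge0// lerDl.
have kE : k%:R = y * s%:R by rewrite /y divfK// gt_eqF.
(* For [y <= 2] the parameter is [r = 2]; [ln (1 + y) <= y] turns [s] into [k], and [ln 2 >= 1 / 2]
   doubles [L], giving [17 * 2 * 2 = 68]. *)
have [y2|y2] := leP y 2.
  have rE : r = 2 by rewrite /rpar; apply/max_idPl.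
  apply: le_trans Ex_msgs_log _; rewrite lee_fin -/x -/L rE ler_pdivlMr//.
  have h1 := ln1Dx_le (ltW y0).
  have l2 : 1 / 2 <= ln 2 :> R by exact: ln_ge_half.
  have l0 : 0 < ln 2 :> R by lra.
  have h2 : L / ln 2 <= 2 * L.
    rewrite ler_pdivrMr// mulrAC -[leLHS]mul1r; apply: ler_wpM2r => //; lra.
  have q0 : 0 <= 1 + L / ln 2 by rewrite addr_ge0// divr_ge0// ltW.
  have s34 : 0 <= 17 * 2 * s%:R :> R by rewrite mulr_ge0// mulr_ge0.
  apply: (@le_trans _ _ (17 * 2 * s%:R * (1 + 2 * L) * y)).
    apply: ler_pM; [exact: mulr_ge0|exact: ltW| |exact: h1].
    by apply: ler_wpM2l => //; rewrite lerD2l.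
  rewrite kE [leLHS](_ : _ = 34 * (s%:R * y) * (1 + 2 * L)); last by ring.
  rewrite [leRHS](_ : _ = 34 * (s%:R * y) * (2 * (1 + L))); last by ring.
  apply: ler_wpM2l; last by lra.
  by apply: mulr_ge0 => //; apply: mulr_ge0 => //; exact: ltW.
have rE : r = y by rewrite /rpar; apply/max_idPr/ltW.
(* If [W < k], then [n <= W < k] and at most [2 * n] messages occur; [mul_ln_le] compares [W] with
   the target. If [k <= W], then [ln (1 + y) <= L] absorbs the additive term. *)
have [Wk|kW] := ltP W k%:R.
  have nW : n%:R <= W.
    rewrite -[n in n%:R]card_ord -sumr_const; apply: ler_sum => i _; exact: w1.
  have nk : (n < k)%N by rewrite -(ltr_nat R); exact: le_lt_trans Wk.
  apply: (@le_trans _ _ ((2 * n)%N%:R)%:E).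
    rewrite -(Ex_cst P); apply: Ex_le; [exact: cmeas_msgs|exact: cmeas_cst|].
    by move=> om; exact: msgs_few_items.
  rewrite lee_fin ler_pdivlMr// natrM.
  have xy : x <= y by rewrite ler_pM2r ?invr_gt0// ltW.
  have := ler_wpM2r (ltW sR) (mul_ln_le x0 xy); rewrite -/L.
  have -> : y * (1 + L) * s%:R = k%:R * (1 + L) by rewrite kE; ring.
  have -> : x * ln (1 + y) * s%:R = W * ln (1 + y) by rewrite /x; field; rewrite gt_eqF.
  have : n%:R * ln (1 + y) <= W * ln (1 + y) by rewrite ler_wpM2r// ltW.
  have : 0 <= k%:R * (1 + L) by rewrite mulr_ge0// ?addr_ge0// ltW.
  lra.
apply: le_trans Ex_msgs_log _; rewrite lee_fin -/x -/L rE ler_pdivlMr//.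
have lyy : 0 < ln y by rewrite ln_gt0; lra.
have yL : ln (1 + y) <= L.
  have : y <= x by rewrite ler_pM2r ?invr_gt0.
  rewrite /L ler_ln ?posrE; lra.
(* This is [1 + y <= y ^+ 2] for [y > 2]; it bounds the last factor by [3 * L], below the
   [4 * (1 + L)] that [68 = 17 * 4] allows. *)
have y2l : ln (1 + y) <= 2 * ln y.
  have -> : 2 * ln y = ln (y ^+ 2) by rewrite lnXn// mulr_natl.
  rewrite ler_ln ?posrE ?exprn_gt0//; nra.
have : L / ln y * ln (1 + y) <= 2 * L.
  by rewrite mulrAC ler_pdivrMr// [leRHS]mulrAC mulrC ler_wpM2r.
have -> : 17 * y * s%:R * (1 + L / ln y) * ln (1 + y) =
   17 * (y * s%:R) * (ln (1 + y) + L / ln y * ln (1 + y)) by ring.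
rewrite -kE => h; rewrite -2!mulrA -[leRHS]mulrA [leRHS](_ : _ = 17 * (k%:R * (4 * (1 + L)))); last by ring.
by rewrite ler_pM2l// ler_pM2l//; lra.
Qed.

End Messages.

Theorem theorem3p8 :
  (* (i) correctness: the query output is a weighted SWOR *)
  (forall (R : realType) (k s n : nat) (w : nat -> R) (site : nat -> 'I_k)
          (d : measure_display) (Omega : measurableType d)
          (P : probability Omega R) (T : nat -> {RV P >-> R}),
     (1 <= k)%N -> (1 <= s)%N ->
     (forall i, (i < n)%N -> 1 <= w i) ->
     mutually_independent n T ->
     (forall i, (i < n)%N -> exp1_distributed (T i)) ->
     forall t : nat, (1 <= t <= n)%N ->
     forall A : {set 'I_n},
       (forall i : 'I_n, i \in A -> (i < t)%N) ->
       #|A| = minn t s ->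
       P [set om | finset (fun i : 'I_n => nat_of_ord i \in query k s w site (keyof w T om) t) = A]
       = (swor_prob w t [seq nat_of_ord i | i <- enum A])%:E)
  /\
  (* (ii) communication: expected number of messages *)
  (exists C : nat, (0 < C)%N /\
   forall (R : realType) (k s n : nat) (w : nat -> R) (site : nat -> 'I_k)
          (d : measure_display) (Omega : measurableType d)
          (P : probability Omega R) (T : nat -> {RV P >-> R}),
     (1 <= k)%N -> (1 <= s)%N ->
     (forall i, (i < n)%N -> 1 <= w i) ->
     mutually_independent n T ->
     (forall i, (i < n)%N -> exp1_distributed (T i)) ->
     let W := \sum_(i < n) w i in
     (\int[P]_om ((msgs (run k s w site (keyof w T om) n))%:R)%:E
      <= (C%:R * k%:R * (1 + ln (1 + W / s%:R)) / ln (1 + k%:R / s%:R))%:E)%E).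
Proof.
split.
  move=> R k s n w site d Omega P T k0 s0 w1 indep expT t /andP[_ tn] A At cA.
  exact: query_swor.
exists 68%N; split=> // R k s n w site d Omega P T k0 s0 w1 indep expT.
exact: expected_msgs_le.
Qed.
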